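(* Let $b<0$, let $\mathcal T=y\,\dfrac{\partial^2}{\partial x^2}+\dfrac{\partial^2}{\partial y^2}$ be the classical Tricomi operator in $\mathbb R^2$, put $a=\tfrac23(-b)^{3/2}$ and, for $y\le 0$, $$u=9(x^2-a^2)+12a(-y)^{3/2}+4y^3,\qquad v=9(x^2-a^2)-12a(-y)^{3/2}+4y^3,$$ $$D_{b,-}=\{(x,y)\in\mathbb R^2:\ y<b,\ 9(x^2-a^2)+12a(-y)^{3/2}+4y^3<0\}.$$ Then the distribution $E_-(\cdot\,;0,b)$ on $\mathbb R^2$ defined by the function $$E_-(x,y;0,b)=\begin{cases}\dfrac{(-v)^{-1/6}}{2^{1/3}}\,F\!\left(\tfrac16,\tfrac16,1;\dfrac uv\right) & \text{in } D_{b,-},\\[2mm] 0&\text{elsewhere,}\end{cases}$$ is a fundamental solution of $\mathcal T$ relative to the point $(0,b)$, and its support is the closure of $D_{b,-}$.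
   Context: $F(\alpha,\beta,\gamma;\zeta)=\sum_{k\ge0}\frac{(\alpha)_k(\beta)_k}{(\gamma)_k\,k!}\zeta^k$ is the Gauss hypergeometric series, with $(\alpha)_0=1$, $(\alpha)_k=\alpha(\alpha+1)\cdots(\alpha+k-1)$. In $D_{b,-}$ one has $u<0$, $v<0$ and $0<u/v<1$, so the formula is meaningful, with $(-v)^{-1/6}$ the positive real power. A fundamental solution of $\mathcal T$ relative to $(0,b)$ is a distribution $E$ on $\mathbb R^2$ with $\mathcal T E=\delta(x,y-b)$ (the Dirac measure at $(0,b)$), i.e. $\langle E,\mathcal T\phi\rangle=\phi(0,b)$ for all $\phi\in C_c^\infty(\mathbb R^2)$. *)

(* Defs.v *)
From mathcomp Require Import all_boot all_order all_algebra.
From mathcomp Require Import all_classical all_reals all_analysis.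

Set Implicit Arguments.
Unset Strict Implicit.
Unset Printing Implicit Defensive.

Import Order.TTheory GRing.Theory Num.Theory.
Import numFieldNormedType.Exports.

Local Open Scope classical_set_scope.
Local Open Scope ring_scope.

Section test_functions.
Variable R : realType.
Implicit Types (f phi : R * R -> R).

Definition partial_x f : R * R -> R := 'D_((1, 0) : R * R) f.
Definition partial_y f : R * R -> R := 'D_((0, 1) : R * R) f.

(* 'D_v f is a total operator (with a junk value where f has no derivative
   along v), hence the explicit derivability conditions. *)
Fixpoint of_class_C (k : nat) f : Prop :=
  if k is k'.+1 then
    [/\ continuous f,
        forall p, derivable f p ((1, 0) : R * R),
        forall p, derivable f p ((0, 1) : R * R),
        of_class_C k' (partial_x f) &
        of_class_C k' (partial_y f)]
  else continuous f.

Definition smooth f : Prop := forall k, of_class_C k f.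

Definition fun_support f : set (R * R) := closure [set p | f p != 0].

Definition test_function phi : Prop := smooth phi /\ compact (fun_support phi).

Definition mixed_partial (i j : nat) f : R * R -> R :=
  iter i partial_x (iter j partial_y f).

Definition test_seminorm (N : nat) phi : R :=
  \sum_(i < N.+1) \sum_(j < N.+1 | (i + j <= N)%N)
    sup (range (fun p => `|mixed_partial i j phi p|)).

End test_functions.

Section distributions.
Variable R : realType.
Implicit Types (T : (R * R -> R) -> R) (f phi psi : R * R -> R).

(* Distributions are represented by functionals on all of R * R -> R; only the
   values on test functions are meaningful.  Continuity is expressed by the
   usual seminorm estimates on each compact set. *)
Definition is_distribution T : Prop :=
  (forall (c : R) phi psi, test_function phi -> test_function psi ->
     T (fun p => c * phi p + psi p) = c * T phi + T psi) /\
  (forall K : set (R * R), compact K ->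
     exists (C : R) (N : nat), forall phi, test_function phi ->
       fun_support phi `<=` K -> `|T phi| <= C * test_seminorm N phi).

Definition vanishes_on T (U : set (R * R)) : Prop :=
  forall phi, test_function phi -> fun_support phi `<=` U -> T phi = 0.

Definition distribution_support T : set (R * R) :=
  ~` \bigcup_(U in [set U | open U /\ vanishes_on T U]) U.

Definition lebesgue2 :
    {measure set (measurableTypeR R * measurableTypeR R) -> \bar R} :=
  (@lebesgue_measure R \x @lebesgue_measure R)%E.

(* lebesgue_integral_differentiation.locally_integrable is restricted to
   functions of one variable. *)
Definition locally_integrable2 f : Prop :=
  measurable_fun [set: measurableTypeR R * measurableTypeR R] f /\
  forall K : set (R * R), compact K -> lebesgue2.-integrable K (EFin \o f).

Definition distribution_of_fun f : (R * R -> R) -> R :=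
  fun phi => Rintegral lebesgue2 setT (fun p => f p * phi p).

End distributions.

Section tricomi.
Variable R : realType.
Implicit Types (b : R) (p : R * R) (phi : R * R -> R).

Definition tricomi phi : R * R -> R :=
  fun p => p.2 * partial_x (partial_x phi) p + partial_y (partial_y phi) p.

(* The Tricomi operator is formally self-adjoint, so that it acts on a
   distribution E by <tricomi E, phi> = <E, tricomi phi>. *)
Definition fundamental_solution (E : (R * R -> R) -> R) p : Prop :=
  is_distribution E /\
  forall phi, test_function phi -> E (tricomi phi) = phi p.

Definition rising_factorial (alpha : R) (k : nat) : R :=
  \prod_(i < k) (alpha + i%:R).

Definition hypergeometric (alpha beta gamma zeta : R) : R :=
  limn (series (fun k : nat =>
    rising_factorial alpha k * rising_factorial beta k /
      (rising_factorial gamma k * (k`!)%:R) * zeta ^+ k)).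

Definition tricomi_a b : R := 2 / 3 * (- b) `^ (3 / 2).

(* tricomi_u and tricomi_v are only meaningful for p.2 <= 0. *)
Definition tricomi_u b p : R :=
  9 * (p.1 ^+ 2 - tricomi_a b ^+ 2)
  + 12 * tricomi_a b * (- p.2) `^ (3 / 2) + 4 * p.2 ^+ 3.

Definition tricomi_v b p : R :=
  9 * (p.1 ^+ 2 - tricomi_a b ^+ 2)
  - 12 * tricomi_a b * (- p.2) `^ (3 / 2) + 4 * p.2 ^+ 3.

Definition D_minus b : set (R * R) := [set p | p.2 < b /\ tricomi_u b p < 0].

Definition E_minus b p : R :=
  if p \in D_minus b then
    (- tricomi_v b p) `^ (- (1 / 6)) / 2 `^ (1 / 3) *
      hypergeometric (1 / 6) (1 / 6) 1 (tricomi_u b p / tricomi_v b p)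
  else 0.

End tricomi.

(* Main.v *)
Require Import Defs.
From mathcomp Require Import all_boot all_order all_algebra.
From mathcomp Require Import all_classical all_reals all_analysis measurable_realfun.
From mathcomp Require Import ring lra.

(* For y < 0 the Tricomi operator is hyperbolic, and the function of
   the theorem is its Riemann function: with w = -v and n = -u, it is the
   restriction to D_{b,-} of a constant multiple of G = w^(-1/6) F(n/w), which
   is smooth near the closure of D_{b,-} and annihilated by the Tricomi operator
   there (this is the hypergeometric equation of F).  For a test function phi,
     G (y phi_xx + phi_yy) = d/dx [y (G phi_x - phi G_x)] + d/dy [G phi_y - phi G_y]
   and Fubini's theorem turns the integral over D_{b,-} into one along the two
   characteristics x = h(y) and x = -h(y) issuing from (0, b).  On these n = 0,
   so F = 1, and the flux through them is the derivative along the characteristic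
   of (-y)^(1/2) G phi, which leaves only the value of phi at (0, b). *)

Set Implicit Arguments.
Unset Strict Implicit.
Unset Printing Implicit Defensive.
Import Order.TTheory GRing.Theory Num.Theory.
Import numFieldNormedType.Exports.

Local Open Scope classical_set_scope.
Local Open Scope ring_scope.

(** The delicate region is the boundary of the cone. With r = sqrt(-y) and rho = sqrt(-b) one has w
    - n = 16 r^3 rho^3 > 0, so the set where y < 0 and |n| < w is an open neighbourhood of the
    closed cone, vertex included. G and its derivatives are continuous there, and each divergence is
    integrated up to the edges without any limiting argument. The cone is unbounded: it is cut by a
    line y = y0 below the support of the test function, so that the base contributes nothing. Test
    functions are known only through their partial derivatives, so differentiating along an edge
    requires a chain rule of its own. Each edge yields rho (16 rho^6)^(-1/6) = 2^(-2/3) times the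
    value at the vertex; the two add up to 2^(1/3), the denominator in [E_minus]. The support is
    found from a sign: the coefficients of F are nonnegative, so F >= 1 on [0, 1), [E_minus] is
    positive on all of [D_minus], and a bump function placed inside detects it. *)

Local Notation plane R := (measurableTypeR R * measurableTypeR R)%type.

(** * Lebesgue measure on the plane *)

Section plane_measure.
Variable R : realType.
Implicit Types (U O K S : set (R * R)) (g : R * R -> R).

(** The plane carries the product sigma-algebra, so an open set is written as the countable union of
    the boxes with rational corners that it contains. *)
Lemma open_measurable2 U : open U -> measurable (U : set (plane R)).
Proof.
move=> oU.
pose box (q : rat * rat * (rat * rat)) : set (plane R) :=
  `]ratr q.1.1, ratr q.1.2[%classic `*` `]ratr q.2.1, ratr q.2.2[%classic.
suff -> : U = \bigcup_q (if pselect (box q `<=` U) then box q else set0).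
  apply: countable_bigcupT_measurable => // q.
  by case: pselect => ? //=; apply: measurableX; exact: measurable_itv.
apply/seteqP; split => [[x y] Uxy|p [q _]]; last by case: pselect => //= + ?; apply.
have /nbhs_ballP[e /= e0 eU] : nbhs (x, y) U by exact: open_nbhs_nbhs.
have rat_around (z : R) : exists q1 q2 : rat,
    z - e < ratr q1 /\ ratr q1 < z /\ z < ratr q2 /\ ratr q2 < z + e.
  have /rat_in_itvoo[q1] : z - e < z by rewrite ltrBlDr ltrDl.
  have /rat_in_itvoo[q2] : z < z + e by rewrite ltrDl.
  by rewrite !in_itv/= => /andP[? ?] /andP[? ?]; exists q1, q2.
have [q1 [q2 [? [? [? ?]]]]] := rat_around x.
have [q3 [q4 [? [? [? ?]]]]] := rat_around y.
exists ((q1, q2), (q3, q4)) => //; case: pselect => [?|[]]/=.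
  by split => /=; rewrite in_itv/=; apply/andP.
move=> [x' y'] [/=]; rewrite !in_itv/= => /andP[? ?] /andP[? ?].
by apply: eU; split; rewrite /ball/= ltr_norml; apply/andP; split; lra.
Qed.

Lemma closed_measurable2 K : closed K -> measurable (K : set (plane R)).
Proof.
by move/closed_openC/open_measurable2/measurableC; rewrite setCK.
Qed.

Lemma compact_closed2 K : compact K -> closed K.
Proof. by apply: compact_closed; exact: norm_hausdorff. Qed.

Lemma compact_measurable2 K : compact K -> measurable (K : set (plane R)).
Proof. by move/compact_closed2/closed_measurable2. Qed.

Lemma compact_box K : compact K ->
  exists M : R, 0 < M /\ forall p, K p -> `|p.1| <= M /\ `|p.2| <= M.
Proof.
move=> /compact_bounded[M0 [_ bK]].
exists (`|M0| + 1); split=> [|p Kp]; first by rewrite ltr_pwDr.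
have /bK/(_ _ Kp)/= : M0 < `|M0| + 1 by rewrite (le_lt_trans (ler_norm _))// ltrDl.
by rewrite /Num.norm/= ge_max => /andP[].
Qed.

Lemma box_compact (M : R) :
  compact ([set p | `|p.1| <= M /\ `|p.2| <= M] : set (R * R)).
Proof.
have -> : [set p | `|p.1| <= M /\ `|p.2| <= M] = `[-M, M] `*` `[-M, M] :> set (R * R).
  by apply/seteqP; split => p /=; rewrite !in_itv/= !ler_norml.
by apply: compact_setX; exact: segment_compact.
Qed.

Lemma compact_finite_measure K : compact K -> (lebesgue2 R K < +oo)%E.
Proof.
move=> cK; have [M [M0 KM]] := compact_box cK.
pose I : set (measurableTypeR R) := `[-M, M]%classic.
have sub : K `<=` I `*` I.
  by move=> p /KM[]; rewrite !ler_norml => ? ?; split; rewrite /I/= in_itv.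
have mI : measurable I by exact: measurable_itv.
apply: (@le_lt_trans _ _ (lebesgue2 R (I `*` I))).
  apply: le_measure => //; rewrite inE; first exact: compact_measurable2.
  exact: measurableX.
have -> : lebesgue2 R (I `*` I) = (lebesgue_measure I * lebesgue_measure I)%E.
  exact: product_measure1E.
rewrite lebesgue_measure_itv/=.
by case: ifP => _; rewrite ?mule0// -!EFinB -EFinM ltry.
Qed.

Lemma continuous_in_measurable2 O g : open O -> {in O, continuous g} ->
  measurable_fun (O : set (plane R)) g.
Proof.
move=> oO cg; apply: (measurability _ (measurable_realfun.RGenOpens.measurableE R)).
move=> _ [_ [a [b ->] <-]]; apply: open_measurable2.
rewrite openE => p [Op gp]; apply: filterI; first by exact: open_nbhs_nbhs.
have /(_ p) := cg; rewrite inE => /(_ Op); apply.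
by apply: open_nbhs_nbhs; split => //; exact: interval_open.
Qed.

Lemma continuous_in_bounded O K g : open O -> {in O, continuous g} ->
  compact K -> K `<=` O -> exists M : R, forall p, K p -> `|g p| <= M.
Proof.
move=> oO cg cK KO.
have /compact_bounded[M0 [_ bK]] : compact (g @` K).
  apply: continuous_compact => //; apply: continuous_in_subspaceT => p.
  by rewrite inE => /KO Op; apply: cg; rewrite inE.
exists (`|M0| + 1) => p Kp.
by apply: (bK (`|M0| + 1)); [rewrite (le_lt_trans (ler_norm _))// ltrDl|exists p].
Qed.

Lemma continuous_in_integrable2 O K S g : open O -> {in O, continuous g} ->
  compact K -> K `<=` O -> measurable (S : set (plane R)) -> S `<=` K ->
  (lebesgue2 R).-integrable S (EFin \o g).
Proof.
move=> oO cg cK KO mS SK.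
have [M bM] := continuous_in_bounded oO cg cK KO.
apply: measurable_bounded_integrable => //.
- apply: le_lt_trans (compact_finite_measure cK).
  by apply: le_measure => //; rewrite inE//; exact: compact_measurable2.
- apply: measurable_funS (continuous_in_measurable2 oO cg).
  + exact: open_measurable2.
  + by move=> p /SK/KO.
- exists M; split; first exact: num_real.
  by move=> N MN p Sp; apply: le_trans (ltW MN); apply: bM; exact: SK.
Qed.

End plane_measure.

(** * Locally integrable functions as distributions of order zero *)

Section functions_as_distributions.
Variable R : realType.
Implicit Types (f phi : R * R -> R) (K U : set (R * R)).

Lemma continuous_compact_support_bounded phi K : continuous phi -> compact K ->
  (forall p, ~ K p -> phi p = 0) -> exists M, forall p, `|phi p| <= M.
Proof.
move=> cphi cK phi0.
have [||M bM] := @continuous_in_bounded R setT K phi openT _ cK.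
- by move=> p _; exact: cphi.
- by [].
exists (Num.max M 0) => p; have [Kp|/phi0 ->] := pselect (K p).
  by rewrite le_max bM.
by rewrite normr0 le_max lexx orbT.
Qed.

Lemma continuous_measurable2 phi : continuous phi ->
  measurable_fun [set: plane R] phi.
Proof.
by move=> cphi; apply: continuous_in_measurable2; [exact: openT|move=> p _; exact: cphi].
Qed.

Lemma mul_restrict_support f phi K : (forall p, ~ K p -> phi p = 0) ->
  (fun p => f p * phi p) = ((fun p => f p * phi p) \_ K).
Proof.
move=> phi0; apply/funext => p; rewrite patchE.
by case: ifPn => // /negP; rewrite inE => /phi0 ->; rewrite mulr0.
Qed.

Lemma integrable_mul_on f phi K : locally_integrable2 f -> continuous phi ->
  compact K -> (forall p, ~ K p -> phi p = 0) ->
  (lebesgue2 R).-integrable K (EFin \o (fun p => f p * phi p)).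
Proof.
move=> [mf fint] cphi cK phi0.
have mK := compact_measurable2 cK.
have [M bM] := continuous_compact_support_bounded cphi cK phi0.
apply: (@integrableMl _ _ _ _ _ mK (EFin \o f) phi); first exact: fint.
  by apply: measurable_funS (continuous_measurable2 cphi).
exists M; split; first exact: num_real.
by move=> N MN p _; apply: le_trans (ltW MN); exact: bM.
Qed.

Lemma integrable_mul f phi K : locally_integrable2 f -> continuous phi ->
  compact K -> (forall p, ~ K p -> phi p = 0) ->
  (lebesgue2 R).-integrable setT (EFin \o (fun p => f p * phi p)).
Proof.
move=> fint cphi cK phi0.
rewrite (mul_restrict_support f phi0) -restrict_EFin.
apply/(integrable_mkcond _ (compact_measurable2 cK)).
exact: (integrable_mul_on fint cphi cK phi0).
Qed.

Lemma support_out phi p : ~ fun_support phi p -> phi p = 0.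
Proof.
by move=> np; apply: contrapT => /eqP ?; apply: np; exact: subset_closure.
Qed.

Lemma test_function_continuous phi : test_function phi -> continuous phi.
Proof. by move=> [/(_ 0%N)]. Qed.

Lemma normr_le_test_seminorm phi p : test_function phi ->
  `|phi p| <= test_seminorm 0%N phi.
Proof.
move=> tphi; rewrite /test_seminorm (big_ord_recl 0%N) big_ord0 addr0.
rewrite big_mkcond big_ord_recl big_ord0 /= addr0.
(* [sup] is an upper bound only of a set that has one, hence the boundedness of phi. *)
have [M bM] := continuous_compact_support_bounded (test_function_continuous tphi)
  tphi.2 (@support_out phi).
by apply: ub_le_sup; [exists M => _ [q _ <-]; exact: bM|exists p].
Qed.

Lemma locally_integrable_distribution f : locally_integrable2 f ->
  is_distribution (distribution_of_fun f).
Proof.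
move=> fint; split=> [c phi psi tphi tpsi|K cK].
  have int xi : test_function xi ->
      (lebesgue2 R).-integrable setT (EFin \o (fun p => f p * xi p)).
    move=> txi; apply: (integrable_mul fint _ txi.2 (@support_out xi)).
    exact: test_function_continuous.
  rewrite /distribution_of_fun -RintegralZl//; last exact: int.
  rewrite -RintegralD//; last 2 first.
  - by rewrite (_ : _ \o _ = fun p => (c%:E * (f p * phi p)%:E)%E)//;
      apply: integrableZl => //; exact: int.
  - exact: int.
  by apply: eq_Rintegral => p _; ring.
(* On K the constant is the L^1 norm of f, and no derivative of phi enters the estimate. *)
exists (\int[lebesgue2 R]_(p in K) `|f p|)%R, 0%N => phi tphi phiK.
have mK := compact_measurable2 cK.
have phi0 p : ~ K p -> phi p = 0 by move=> Kp; apply: support_out => /phiK.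
have iK := integrable_mul_on fint (test_function_continuous tphi) cK phi0.
rewrite /distribution_of_fun (mul_restrict_support f phi0) -Rintegral_mkcond.
apply: le_trans (le_normr_Rintegral mK iK) _.
have ifK : (lebesgue2 R).-integrable K (EFin \o (fun p => `|f p|)).
  exact: integrable_abse (fint.2 _ cK).
rewrite -RintegralZr//; apply: le_Rintegral => //.
- exact: integrable_abse iK.
- rewrite (_ : _ \o _ = fun p => ((`|f p|)%:E * (test_seminorm 0%N phi)%:E)%E)//.
  exact: integrableZr.
move=> p _; rewrite normrM ler_wpM2l//; exact: normr_le_test_seminorm.
Qed.

End functions_as_distributions.

(** * The hypergeometric function F(1/6, 1/6, 1; z) *)

Section power_series_unit_disc.
Variable R : realType.
Implicit Types (d : nat -> R) (z y : R).

(* Equivalent to a radius of convergence of [pseries d] at least 1. *)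
Definition unit_disc_bounded d := forall y, 0 < y -> y < 1 ->
  exists C, forall k, `|d k| * y ^+ k <= C.

(** Bernoulli's inequality. *)
Lemma ler1Dn_expr (e : R) n : 0 <= e -> 1 + n%:R * e <= (1 + e) ^+ n.
Proof.
move=> e0; elim: n => [|n IH]; first by rewrite mul0r addr0 expr0.
rewrite exprS; apply: le_trans (_ : (1 + e) * (1 + n%:R * e) <= _); last first.
  by rewrite ler_wpM2l// addr_ge0.
rewrite -natr1 -subr_ge0.
have -> : (1 + e) * (1 + n%:R * e) - (1 + (n%:R + 1) * e) = n%:R * (e * e) by ring.
by rewrite mulr_ge0// mulr_ge0.
Qed.

(** The factor k + 1 is absorbed by enlarging y to some z < 1: with z / y = 1 + e, Bernoulli gives k
    + 1 <= (1 + 1/e) (1 + k e) <= (1 + 1/e) (z / y)^k. *)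
Lemma unit_disc_bounded_diffs d :
  unit_disc_bounded d -> unit_disc_bounded (pseries_diffs d).
Proof.
move=> dd y y0 y1.
have [z [yz z1]] : exists z, y < z /\ z < 1 by exists ((1 + y) / 2); split; lra.
have z0 : 0 < z by rewrite (lt_trans y0).
have [C bC] := dd _ z0 z1; pose e := z / y - 1.
have e0 : 0 < e by rewrite /e subr_gt0 ltr_pdivlMr// mul1r.
have eE : y / z = (1 + e)^-1 by rewrite /e addrCA subrr addr0 invf_div.
clearbody e; have e1 : 0 < 1 + e by rewrite addr_gt0.
have C0 : 0 <= C by apply: le_trans (bC 0%N); rewrite mulr_ge0// exprn_ge0// ltW.
exists (C * (z^-1 * (1 + e^-1))) => k.
rewrite /pseries_diffs normrM normr_nat.
have -> : k.+1%:R * `|d k.+1| * y ^+ k =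
    (`|d k.+1| * z ^+ k.+1) * (z^-1 * (k.+1%:R * (y / z) ^+ k)).
  rewrite exprS expr_div_n; field.
  by rewrite expf_neq0 gt_eqF.
apply: ler_pM => //.
- by rewrite mulr_ge0// exprn_ge0// ltW.
- by rewrite mulr_ge0 ?invr_ge0 ?(ltW z0)// mulr_ge0// exprn_ge0// divr_ge0// ltW.
rewrite ler_wpM2l ?invr_ge0 ?(ltW z0)//.
rewrite eE exprVn ler_pdivrMr ?exprn_gt0//.
apply: le_trans (_ : (1 + e^-1) * (1 + k%:R * e) <= _); last first.
  by rewrite ler_wpM2l ?ler1Dn_expr ?addr_ge0 ?invr_ge0// ltW.
rewrite -subr_ge0 -natr1.
have -> : (1 + e^-1) * (1 + k%:R * e) - (k%:R + 1) = k%:R * e + e^-1.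
  by field; rewrite gt_eqF.
by rewrite addr_ge0 ?invr_ge0 ?mulr_ge0// ltW.
Qed.

(** Comparison with a geometric series of ratio |z| / y, where y is the midpoint of |z| and 1. *)
Lemma unit_disc_cvg d z : unit_disc_bounded d -> `|z| < 1 -> cvgn (pseries d z).
Proof.
move=> dd z1; pose y := (1 + `|z|) / 2.
have z0 := normr_ge0 z.
have y0 : 0 < y by rewrite /y; lra.
have zy : `|z| < y by rewrite /y; lra.
have y1 : y < 1 by rewrite /y; lra.
have [C bC] := dd _ y0 y1.
apply: normed_cvg; apply: (@series_le_cvg _ _ (geometric C (`|z| / y))).
- by move=> n; exact: normr_ge0.
- move=> n /=; apply: mulr_ge0; first by apply: le_trans (bC n);
    rewrite mulr_ge0// exprn_ge0// ltW.
  by rewrite exprn_ge0// divr_ge0// ltW.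
- move=> n /=; rewrite /geometric/= normrM normrX expr_div_n mulrCA.
  by rewrite [leLHS]mulrC ler_wpM2l ?exprn_ge0// ler_pdivlMr ?exprn_gt0.
- by apply: is_cvg_geometric_series;
    rewrite normf_div normr_id (gtr0_norm y0) ltr_pdivrMr// mul1r.
Qed.

(** Termwise differentiation holds at z once the series and its first two formal derivatives
    converge at some y of larger modulus; the midpoint of |z| and 1 serves. *)
Lemma is_derive_unit_disc d z : unit_disc_bounded d -> `|z| < 1 ->
  is_derive z (1 : R) (fun x => limn (pseries d x)) (limn (pseries (pseries_diffs d) z)).
Proof.
move=> dd z1; pose y := (1 + `|z|) / 2.
have z0 := normr_ge0 z.
have yE : `|y| = y by rewrite ger0_norm// /y; lra.
have y1 : `|y| < 1 by rewrite yE /y; lra.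
apply: (@pseries_snd_diffs _ _ y).
- exact: unit_disc_cvg.
- by apply: unit_disc_cvg => //; exact: unit_disc_bounded_diffs.
- by apply: unit_disc_cvg => //; do 2!apply: unit_disc_bounded_diffs.
- by rewrite yE /y; lra.
Qed.

End power_series_unit_disc.

Section hypergeometric_sixth.
Variable R : realType.
Implicit Type z : R.

Definition hyper_coeff (k : nat) : R :=
  rising_factorial (1 / 6) k * rising_factorial (1 / 6) k /
    (rising_factorial 1 k * (k`!)%:R).

Definition hyperF z := limn (pseries hyper_coeff z).
Definition hyperF1 z := limn (pseries (pseries_diffs hyper_coeff) z).
Definition hyperF2 z := limn (pseries (pseries_diffs (pseries_diffs hyper_coeff)) z).

Lemma hypergeometric_sixthE z : hypergeometric (1 / 6) (1 / 6) 1 z = hyperF z.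
Proof. by []. Qed.

Lemma hyper_coeff0 : hyper_coeff 0 = 1.
Proof. by rewrite /hyper_coeff /rising_factorial !big_ord0 fact0 !mulr1 divr1. Qed.

(** Since gamma = 1, the Pochhammer symbol and the factorial in the denominator each gain a factor k
    + 1. This recurrence is the hypergeometric equation read on coefficients. *)
Lemma hyper_coeffS k :
  (k.+1%:R) ^+ 2 * hyper_coeff k.+1 = (k%:R + 1 / 6) ^+ 2 * hyper_coeff k.
Proof.
have rf1 n : rising_factorial (1 : R) n != 0.
  by rewrite gt_eqF// prodr_gt0// => i _; rewrite ltr_pwDl.
rewrite /hyper_coeff factS natrM /rising_factorial !big_ord_recr /=.
rewrite -/(rising_factorial (1 / 6) k) -/(rising_factorial 1 k).
rewrite nat1r; field; by rewrite rf1 nat1r !pnatr_eq0 -!lt0n fact_gt0.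
Qed.

Lemma hyper_coeff_ge0 k : 0 <= hyper_coeff k.
Proof.
apply: divr_ge0; first by apply: mulr_ge0; apply: prodr_ge0 => i _; apply: addr_ge0.
by apply: mulr_ge0 => //; apply: prodr_ge0 => i _; apply: addr_ge0.
Qed.

Lemma hyper_coeff_le1 k : hyper_coeff k <= 1.
Proof.
elim: k => [|k IH]; first by rewrite hyper_coeff0.
have k0 : (0 : R) < k.+1%:R ^+ 2 by rewrite exprn_gt0.
rewrite -(ler_pM2l k0) hyper_coeffS mulr1.
apply: le_trans (_ : (k%:R + 1 / 6) ^+ 2 <= _); first by rewrite ler_piMr// sqr_ge0.
by rewrite -[k.+1%:R]natr1 lerXn2r ?nnegrE ?addr_ge0// lerD2l; lra.
Qed.

Lemma hyper_coeff_bounded : unit_disc_bounded hyper_coeff.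
Proof.
move=> y y0 y1; exists 1 => k; rewrite ger0_norm ?hyper_coeff_ge0//.
by rewrite mulr_ile1 ?hyper_coeff_ge0 ?hyper_coeff_le1 ?exprn_ge0 ?exprn_ile1// ltW.
Qed.

Lemma is_derive_hyperF z : `|z| < 1 -> is_derive z (1 : R) hyperF (hyperF1 z).
Proof. exact: (is_derive_unit_disc hyper_coeff_bounded). Qed.

Lemma is_derive_hyperF1 z : `|z| < 1 -> is_derive z (1 : R) hyperF1 (hyperF2 z).
Proof. exact: (is_derive_unit_disc (unit_disc_bounded_diffs hyper_coeff_bounded)). Qed.

Lemma continuous_hyperF z : `|z| < 1 -> {for z, continuous hyperF}.
Proof.
move=> z1; apply: differentiable_continuous; apply/derivable1_diffP.
exact: (is_derive_hyperF z1).(ex_derive).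
Qed.

Lemma continuous_hyperF1 z : `|z| < 1 -> {for z, continuous hyperF1}.
Proof.
move=> z1; apply: differentiable_continuous; apply/derivable1_diffP.
exact: (is_derive_hyperF1 z1).(ex_derive).
Qed.

Lemma continuous_hyperF2 z : `|z| < 1 -> {for z, continuous hyperF2}.
Proof.
move=> z1; apply: differentiable_continuous; apply/derivable1_diffP.
have bdd := unit_disc_bounded_diffs (unit_disc_bounded_diffs hyper_coeff_bounded).
exact: (is_derive_unit_disc bdd z1).(ex_derive).
Qed.

Lemma hyperF0 : hyperF 0 = 1.
Proof.
apply: cvg_lim => //; rewrite -(cvg_shiftn 1%N) /=; apply: cvg_near_cst.
near=> n; rewrite /pseries /series/= addn1 big_nat_recl//=.
by rewrite hyper_coeff0 expr0 mulr1 big1 ?addr0// => i _; rewrite expr0n mulr0.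
Unshelve. all: by end_near. Qed.

(** The partial sums increase, and the one with a single term equals 1. The positivity of [E_minus]
    rests on this bound. *)
Lemma hyperF_ge1 z : 0 <= z -> z < 1 -> 1 <= hyperF z.
Proof.
move=> z0 z1; have cz : cvgn (pseries hyper_coeff z).
  by apply: unit_disc_cvg hyper_coeff_bounded _; rewrite ger0_norm.
apply: le_trans (nondecreasing_cvgn_le _ cz 1%N).
  by rewrite /pseries/series/= big_nat1 hyper_coeff0 expr0 mulr1.
apply/nondecreasing_seqP => n; rewrite /pseries/series/= big_nat_recr//= lerDl.
by rewrite mulr_ge0 ?hyper_coeff_ge0// exprn_ge0.
Qed.

Let d0 := hyper_coeff.
Let d1 := pseries_diffs d0.
Let d2 := pseries_diffs d1.

(* Both sides satisfy the same recurrence in [n] by [hyper_coeffS]; the right-hand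
   side is the boundary term left over by the telescoping. *)
Lemma hyper_ode_partial z n :
  z * (1 - z) * pseries d2 z n + (1 - 4 / 3 * z) * pseries d1 z n
    - 1 / 36 * pseries d0 z n =
  z ^+ n * (n%:R * d1 n - n%:R * (n%:R - 1) * d0 n - 4 / 3 * (n%:R * d0 n))
  - z ^+ n.+1 * (n%:R * d1 n).
Proof.
elim: n => [|n IH].
  by rewrite /pseries/series/= !big_geq// expr0; ring.
have rec (d : nat -> R) : pseries d z n.+1 = pseries d z n + d n * z ^+ n.
  by rewrite /pseries/series/= big_nat_recr.
rewrite !rec.
have -> (a b c A B C A' B' C' : R) : a * (A + A') + b * (B + B') - c * (C + C') =
   (a * A + b * B - c * C) + (a * A' + b * B' - c * C') by ring.
rewrite IH.
have c1 : n.+1%:R * d1 n = (n%:R + 1 / 6) ^+ 2 * d0 n.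
  by rewrite -hyper_coeffS /d1 /d0 /pseries_diffs; ring.
have c2 : d2 n = n.+1%:R * d1 n.+1 by [].
have c3 : d1 n = n.+1%:R * d0 n.+1 by [].
have n1 : n.+1%:R = n%:R + 1 :> R by rewrite natr1.
rewrite c2 c3 !n1 !exprS; rewrite c3 n1 in c1.
move: c1; set c := d0 n.+1; set v := d0 n; set w := d1 n.+1.
set N := n%:R; set Z := z ^+ n => c1.
apply/eqP; rewrite -subr_eq0; apply/eqP.
transitivity (Z * ((N + 1) * ((N + 1) * c) - (N + 1 / 6) ^+ 2 * v)); first by field.
by rewrite c1 subrr mulr0.
Qed.

Lemma hyperF_ode z : `|z| < 1 ->
  z * (1 - z) * hyperF2 z + (1 - 4 / 3 * z) * hyperF1 z - 1 / 36 * hyperF z = 0.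
Proof.
move=> z1.
have b0 := hyper_coeff_bounded.
have b1 := unit_disc_bounded_diffs b0; have b2 := unit_disc_bounded_diffs b1.
have [v0 v1 v2] : [/\ cvgn (pseries d0 z), cvgn (pseries d1 z) & cvgn (pseries d2 z)].
  by split; exact: unit_disc_cvg.
pose L n := z * (1 - z) * pseries d2 z n + (1 - 4 / 3 * z) * pseries d1 z n
    - 1 / 36 * pseries d0 z n.
have Lcvg : L n @[n --> \oo] --> z * (1 - z) * hyperF2 z
    + (1 - 4 / 3 * z) * hyperF1 z - 1 / 36 * hyperF z.
  by apply: cvgB; [apply: cvgD|]; apply: cvgMr => //.
suff L0 : L n @[n --> \oo] --> 0.
  exact: (cvg_unique _ Lcvg L0).
(* With the index n + 2, the polynomial factors of the boundary term are absorbed into [d1] and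
   [d2]; what remains are multiples of general terms of convergent series, which tend to 0. *)
rewrite -(cvg_shiftn 2%N) /=.
have t1 := cvg_series_cvg_0 v1; have t2 := cvg_series_cvg_0 v2.
have -> : (fun n => L (n + 2)%N) = (fun n => (z * (d2 n.+1 * z ^+ n.+1)
  - z ^+ 2 * (d2 n * z ^+ n)) - 4 / 3 * z * (d1 n.+1 * z ^+ n.+1)
  - z ^+ 2 * (d2 n.+1 * z ^+ n.+1)).
  apply/funext => n; rewrite /L hyper_ode_partial addn2.
  have -> : d2 n.+1 = n.+2%:R * d1 n.+2 by [].
  have -> : d2 n = n.+1%:R * d1 n.+1 by [].
  have -> : d1 n.+1 = n.+2%:R * d0 n.+2 by [].
  have -> : n.+2%:R = n.+1%:R + 1 :> R by rewrite natr1.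
  by rewrite !exprS; field.
have t1' : d1 n.+1 * z ^+ n.+1 @[n --> \oo] --> 0 by move: t1; rewrite -cvg_shiftS.
have t2' : d2 n.+1 * z ^+ n.+1 @[n --> \oo] --> 0 by move: t2; rewrite -cvg_shiftS.
have : z * (d2 n.+1 * z ^+ n.+1) - z ^+ 2 * (d2 n * z ^+ n)
    - 4 / 3 * z * (d1 n.+1 * z ^+ n.+1) - z ^+ 2 * (d2 n.+1 * z ^+ n.+1)
    @[n --> \oo] --> z * 0 - z ^+ 2 * 0 - 4 / 3 * z * 0 - z ^+ 2 * 0.
  by apply: cvgB; [apply: cvgB; [apply: cvgB|]|]; apply: cvgMr.
by rewrite !mulr0 !subr0.
Qed.

End hypergeometric_sixth.

(** * The Riemann function *)

Section derive_pointwise.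
Variable R : realType.
Implicit Types (f g : R -> R) (t a c df dg : R).

Lemma is_derive_add t f g df dg : is_derive t (1 : R) f df ->
  is_derive t (1 : R) g dg -> is_derive t (1 : R) (fun s => f s + g s) (df + dg).
Proof. by move=> Hf Hg; exact: is_deriveD. Qed.

Lemma is_derive_sub t f g df dg : is_derive t (1 : R) f df ->
  is_derive t (1 : R) g dg -> is_derive t (1 : R) (fun s => f s - g s) (df - dg).
Proof. by move=> Hf Hg; exact: is_deriveB. Qed.

Lemma is_derive_mul t f g df dg : is_derive t (1 : R) f df ->
  is_derive t (1 : R) g dg ->
  is_derive t (1 : R) (fun s => f s * g s) (df * g t + f t * dg).
Proof.
move=> Hf Hg; apply: is_derive_eq (is_deriveM Hf Hg) _.
by rewrite addrC [_ *: df]mulrC.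
Qed.

Lemma is_derive_const t c : is_derive t (1 : R) (fun=> c) 0.
Proof. exact: is_derive_cst. Qed.

Lemma is_derive_scale t c f df : is_derive t (1 : R) f df ->
  is_derive t (1 : R) (fun s => c * f s) (c * df).
Proof. by move=> Hf; exact: is_deriveZ. Qed.

Lemma is_derive_expr t f df n : is_derive t (1 : R) f df ->
  is_derive t (1 : R) (fun s => f s ^+ n) (n%:R * f t ^+ n.-1 * df).
Proof.
move=> Hf; have -> : (fun s => f s ^+ n) = f ^+ n by apply/funext => s; rewrite exprfctE.
exact: is_deriveX.
Qed.

Lemma is_derive_inv t f df : f t != 0 -> is_derive t (1 : R) f df ->
  is_derive t (1 : R) (fun s => (f s)^-1) (- df / f t ^+ 2).
Proof.
by move=> f0 Hf; apply: is_derive_eq (is_deriveV f0 Hf) _; rewrite mulNr scaleNr [_ *: df]mulrC.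
Qed.

(** The quotient rule as z' = (f' - z g') / g with z = f / g. It can be differentiated again by the
    same rule, and [zeta1] and [zeta2] have this shape. *)
Lemma is_derive_ratio t f g df dg : g t != 0 -> is_derive t (1 : R) f df ->
  is_derive t (1 : R) g dg ->
  is_derive t (1 : R) (fun s => f s / g s) ((df - f t / g t * dg) / g t).
Proof.
move=> g0 Hf Hg.
by apply: is_derive_eq (is_derive_mul Hf (is_derive_inv g0 Hg)) _; field.
Qed.

Lemma is_derive_powR_comp t a f df : 0 < f t -> is_derive t (1 : R) f df ->
  is_derive t (1 : R) (fun s => f s `^ a) (a * (df / f t) * f t `^ a).
Proof.
move=> f0 Hf.
apply: is_derive_eq (is_derive1_comp (is_derive1_powR a f0) Hf) _.
rewrite powRB; last by rewrite (gt_eqF f0) implybT.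
by rewrite powRr1 ?ltW//; field; rewrite gt_eqF.
Qed.

Lemma is_derive_chain t (h : R -> R) f dh df : is_derive (f t) (1 : R) h dh ->
  is_derive t (1 : R) f df -> is_derive t (1 : R) (fun s => h (f s)) (dh * df).
Proof. by move=> Hh Hf; exact: (is_derive1_comp Hh Hf). Qed.

End derive_pointwise.

Section riemann_profile.
Variable R : realType.

Definition profile (w n : R) : R := w `^ (- (1 / 6)) * hyperF (n / w).

(* If [w1], [w2] and [n1], [n2] are the first and second derivatives of [w] and
   [n], then [zeta1], [zeta2] are those of [n / w], and [profile1], [profile2]
   those of [profile w n]. *)
Definition zeta1 (w w1 n n1 : R) : R := (n1 - n / w * w1) / w.

Definition zeta2 (w w1 w2 n n1 n2 : R) : R :=
  (n2 - 2 * zeta1 w w1 n n1 * w1 - n / w * w2) / w.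

Definition profile1 (w w1 n n1 : R) : R :=
  w `^ (- (1 / 6)) *
    (zeta1 w w1 n n1 * hyperF1 (n / w) - 1 / 6 * (w1 / w) * hyperF (n / w)).

Definition profile2 (w w1 w2 n n1 n2 : R) : R :=
  w `^ (- (1 / 6)) *
    (zeta1 w w1 n n1 ^+ 2 * hyperF2 (n / w)
     + (zeta2 w w1 w2 n n1 n2 - 1 / 3 * (w1 / w) * zeta1 w w1 n n1) * hyperF1 (n / w)
     + (7 / 36 * (w1 / w) ^+ 2 - 1 / 6 * (w2 / w)) * hyperF (n / w)).

Lemma is_derive_profile (t w1 n1 : R) (w n : R -> R) : 0 < w t -> `|n t| < w t ->
  is_derive t (1 : R) w w1 -> is_derive t (1 : R) n n1 ->
  is_derive t (1 : R) (fun s => profile (w s) (n s)) (profile1 (w t) w1 (n t) n1).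
Proof.
move=> w0 nw dw dn.
have wn0 : w t != 0 by rewrite gt_eqF.
have z1 : `|n t / w t| < 1 by rewrite normf_div (gtr0_norm w0) ltr_pdivrMr// mul1r.
have dz := is_derive_ratio wn0 dn dw.
have dF := is_derive_chain (f := fun s => n s / w s) (is_derive_hyperF z1) dz.
apply: is_derive_eq (is_derive_mul (is_derive_powR_comp _ w0 dw) dF) _.
by rewrite /profile1 /zeta1; field.
Qed.

Lemma is_derive_profile1 (t w2 n2 : R) (w n w1 n1 : R -> R) : 0 < w t -> `|n t| < w t ->
  is_derive t (1 : R) w (w1 t) -> is_derive t (1 : R) n (n1 t) ->
  is_derive t (1 : R) w1 w2 -> is_derive t (1 : R) n1 n2 ->
  is_derive t (1 : R) (fun s => profile1 (w s) (w1 s) (n s) (n1 s))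
    (profile2 (w t) (w1 t) w2 (n t) (n1 t) n2).
Proof.
move=> w0 nw dw dn dw1 dn1.
have wn0 : w t != 0 by rewrite gt_eqF.
have z1 : `|n t / w t| < 1 by rewrite normf_div (gtr0_norm w0) ltr_pdivrMr// mul1r.
have dz := is_derive_ratio wn0 dn dw.
have dF := is_derive_chain (f := fun s => n s / w s) (is_derive_hyperF z1) dz.
have dF1 := is_derive_chain (f := fun s => n s / w s) (is_derive_hyperF1 z1) dz.
have dz1 := is_derive_ratio wn0 (is_derive_sub dn1 (is_derive_mul dz dw1)) dw.
have dl := is_derive_scale (1 / 6) (is_derive_ratio wn0 dw1 dw).
apply: is_derive_eq (is_derive_mul (is_derive_powR_comp _ w0 dw)
  (is_derive_sub (is_derive_mul dz1 dF1) (is_derive_mul dl dF))) _.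
by rewrite /profile2 /zeta2 /zeta1; field.
Qed.

End riemann_profile.

Section tricomi_riemann.
Variables (R : realType) (b : R).
Implicit Types (x y : R) (p : R * R).

Definition sqrt_opp y : R := Num.sqrt (- y).
Let rho := sqrt_opp b.

(* [coneW] is [- tricomi_v] and [coneN] is [- tricomi_u] (for [p.2 <= 0]), with
   all powers of [- p.2] expressed through its square root. *)
Definition coneW p : R := 4 * (sqrt_opp p.2 ^+ 3 + rho ^+ 3) ^+ 2 - 9 * p.1 ^+ 2.
Definition coneN p : R := 4 * (sqrt_opp p.2 ^+ 3 - rho ^+ 3) ^+ 2 - 9 * p.1 ^+ 2.
Definition cone_x p : R := - 18 * p.1.
Definition coneW_y p : R := - 12 * (sqrt_opp p.2 * (sqrt_opp p.2 ^+ 3 + rho ^+ 3)).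
Definition coneN_y p : R := - 12 * (sqrt_opp p.2 * (sqrt_opp p.2 ^+ 3 - rho ^+ 3)).
Definition coneW_yy p : R := 24 * sqrt_opp p.2 ^+ 2 + 6 * (rho ^+ 3 / sqrt_opp p.2).
Definition coneN_yy p : R := 24 * sqrt_opp p.2 ^+ 2 - 6 * (rho ^+ 3 / sqrt_opp p.2).

Definition riemann p : R := profile (coneW p) (coneN p).
Definition riemann_x p : R := profile1 (coneW p) (cone_x p) (coneN p) (cone_x p).
Definition riemann_y p : R := profile1 (coneW p) (coneW_y p) (coneN p) (coneN_y p).
Definition riemann_xx p : R :=
  profile2 (coneW p) (cone_x p) (- 18) (coneN p) (cone_x p) (- 18).
Definition riemann_yy p : R :=
  profile2 (coneW p) (coneW_y p) (coneW_yy p) (coneN p) (coneN_y p) (coneN_yy p).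

(** The part of the lower half-plane where the series of F converges at n / w. It is open and
    contains the closed cone, edges and vertex included, so G can be differentiated on the edges
    themselves. *)
Definition riemann_dom : set (R * R) :=
  [set p | p.2 < 0 /\ `|coneN p| < coneW p].

Lemma sqrt_opp_gt0 y : y < 0 -> 0 < sqrt_opp y.
Proof. by move=> y0; rewrite sqrtr_gt0 oppr_gt0. Qed.

Lemma sqrt_opp_sqr y : y < 0 -> sqrt_opp y ^+ 2 = - y.
Proof. by move=> y0; rewrite sqr_sqrtr// oppr_ge0 ltW. Qed.

Lemma is_derive_sqrt_opp y : y < 0 -> is_derive y (1 : R) sqrt_opp (- (2 * sqrt_opp y)^-1).
Proof.
move=> y0; have Ny : 0 < - y by rewrite oppr_gt0.
have dN : is_derive y (1 : R) (fun s => - s) (- 1).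
  by apply: is_deriveN; exact: is_derive_id.
by apply: is_derive_eq (is_derive_chain (is_derive1_sqrt Ny) dN) _; rewrite mulrN1.
Qed.

Lemma is_derive_coneW_x x y :
  is_derive x (1 : R) (fun s => coneW (s, y)) (cone_x (x, y)).
Proof.
apply: is_derive_eq (is_derive_sub (is_derive_const x (4 * (sqrt_opp y ^+ 3 + rho ^+ 3) ^+ 2))
  (is_derive_scale 9 (is_derive_expr 2 (is_derive_id x 1)))) _.
by rewrite /cone_x /=; ring.
Qed.

Lemma is_derive_coneN_x x y :
  is_derive x (1 : R) (fun s => coneN (s, y)) (cone_x (x, y)).
Proof.
apply: is_derive_eq (is_derive_sub (is_derive_const x (4 * (sqrt_opp y ^+ 3 - rho ^+ 3) ^+ 2))
  (is_derive_scale 9 (is_derive_expr 2 (is_derive_id x 1)))) _.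
by rewrite /cone_x /=; ring.
Qed.

Lemma is_derive_cone_x x y :
  is_derive x (1 : R) (fun s => cone_x (s, y)) (- 18).
Proof.
by apply: is_derive_eq (is_derive_scale (- 18) (is_derive_id x 1)) _; rewrite mulr1.
Qed.

Lemma is_derive_coneW_y x y : y < 0 ->
  is_derive y (1 : R) (fun s => coneW (x, s)) (coneW_y (x, y)).
Proof.
move=> y0; have r0 : sqrt_opp y != 0 by rewrite gt_eqF// sqrt_opp_gt0.
have d3 := is_derive_add (is_derive_expr 3 (is_derive_sqrt_opp y0)) (is_derive_const y
  (rho ^+ 3)).
apply: is_derive_eq (is_derive_sub (is_derive_scale 4 (is_derive_expr 2 d3))
  (is_derive_const y (9 * x ^+ 2))) _.
by rewrite /coneW_y /=; field.
Qed.

Lemma is_derive_coneN_y x y : y < 0 ->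
  is_derive y (1 : R) (fun s => coneN (x, s)) (coneN_y (x, y)).
Proof.
move=> y0; have r0 : sqrt_opp y != 0 by rewrite gt_eqF// sqrt_opp_gt0.
have d3 := is_derive_sub (is_derive_expr 3 (is_derive_sqrt_opp y0)) (is_derive_const y
  (rho ^+ 3)).
apply: is_derive_eq (is_derive_sub (is_derive_scale 4 (is_derive_expr 2 d3))
  (is_derive_const y (9 * x ^+ 2))) _.
by rewrite /coneN_y /=; field.
Qed.

Lemma is_derive_coneW_yy x y : y < 0 ->
  is_derive y (1 : R) (fun s => coneW_y (x, s)) (coneW_yy (x, y)).
Proof.
move=> y0; have r0 : sqrt_opp y != 0 by rewrite gt_eqF// sqrt_opp_gt0.
have d3 := is_derive_add (is_derive_expr 3 (is_derive_sqrt_opp y0)) (is_derive_const y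
  (rho ^+ 3)).
apply: is_derive_eq (is_derive_scale (- 12) (is_derive_mul (is_derive_sqrt_opp y0) d3)) _.
by rewrite /coneW_yy /=; field.
Qed.

Lemma is_derive_coneN_yy x y : y < 0 ->
  is_derive y (1 : R) (fun s => coneN_y (x, s)) (coneN_yy (x, y)).
Proof.
move=> y0; have r0 : sqrt_opp y != 0 by rewrite gt_eqF// sqrt_opp_gt0.
have d3 := is_derive_sub (is_derive_expr 3 (is_derive_sqrt_opp y0)) (is_derive_const y
  (rho ^+ 3)).
apply: is_derive_eq (is_derive_scale (- 12) (is_derive_mul (is_derive_sqrt_opp y0) d3)) _.
by rewrite /coneN_yy /=; field.
Qed.

Lemma riemann_dom_W p : riemann_dom p -> 0 < coneW p.
Proof. by move=> [_]; apply: le_lt_trans. Qed.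

Lemma is_derive_riemann_x x y : riemann_dom (x, y) ->
  is_derive x (1 : R) (fun s => riemann (s, y)) (riemann_x (x, y)).
Proof.
move=> D; have [_ nw] := D; have w0 := riemann_dom_W D.
exact: (is_derive_profile (w := fun s => coneW (s, y)) (n := fun s => coneN (s, y))
  w0 nw (is_derive_coneW_x _ _) (is_derive_coneN_x _ _)).
Qed.

Lemma is_derive_riemann_xx x y : riemann_dom (x, y) ->
  is_derive x (1 : R) (fun s => riemann_x (s, y)) (riemann_xx (x, y)).
Proof.
move=> D; have [_ nw] := D; have w0 := riemann_dom_W D.
exact: (is_derive_profile1 (w := fun s => coneW (s, y)) (n := fun s => coneN (s, y))
  (w1 := fun s => cone_x (s, y)) (n1 := fun s => cone_x (s, y))
  w0 nw (is_derive_coneW_x _ _) (is_derive_coneN_x _ _)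
  (is_derive_cone_x _ _) (is_derive_cone_x _ _)).
Qed.

Lemma is_derive_riemann_y x y : riemann_dom (x, y) ->
  is_derive y (1 : R) (fun s => riemann (x, s)) (riemann_y (x, y)).
Proof.
move=> D; have [y0 nw] := D; have w0 := riemann_dom_W D.
exact: (is_derive_profile (w := fun s => coneW (x, s)) (n := fun s => coneN (x, s))
  w0 nw (is_derive_coneW_y _ y0) (is_derive_coneN_y _ y0)).
Qed.

Lemma is_derive_riemann_yy x y : riemann_dom (x, y) ->
  is_derive y (1 : R) (fun s => riemann_y (x, s)) (riemann_yy (x, y)).
Proof.
move=> D; have [y0 nw] := D; have w0 := riemann_dom_W D.
exact: (is_derive_profile1 (w := fun s => coneW (x, s)) (n := fun s => coneN (x, s))
  (w1 := fun s => coneW_y (x, s)) (n1 := fun s => coneN_y (x, s))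
  w0 nw (is_derive_coneW_y _ y0) (is_derive_coneN_y _ y0)
  (is_derive_coneW_yy _ y0) (is_derive_coneN_yy _ y0)).
Qed.

Lemma tricomi_riemann p : riemann_dom p -> p.2 * riemann_xx p + riemann_yy p = 0.
Proof.
move=> D; have [y0 nw] := D; have w0 := riemann_dom_W D.
have z1 : `|coneN p / coneW p| < 1.
  by rewrite normf_div (gtr0_norm w0) ltr_pdivrMr// mul1r.
have := hyperF_ode z1.
have wn0 : coneW p != 0 by rewrite gt_eqF.
have rn0 : sqrt_opp p.2 != 0 by rewrite gt_eqF// sqrt_opp_gt0.
have -> : p.2 = - sqrt_opp p.2 ^+ 2 by rewrite sqrt_opp_sqr// opprK.
rewrite /riemann_xx /riemann_yy /profile2 /zeta2 /zeta1.
set F := hyperF _; set F1 := hyperF1 _; set F2 := hyperF2 _; set k := _ `^ _.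
move: wn0; rewrite /coneW_yy /coneN_yy /coneW_y /coneN_y /cone_x /coneN /coneW.
move: F F1 F2 k rn0; rewrite -/(sqrt_opp p.2).
set r := sqrt_opp p.2; set x := p.1 => F F1 F2 k rn0 wn0 ode.
(* The operator turns w^(-1/6) F(n / w) into w^(-1/6) 36 rho^3 / (r w) times the hypergeometric
   expression. The factor shows in the coefficient of F: y w_x^2 + w_y^2 = 36 r^2 w and y w_xx +
   w_yy = 42 r^2 + 6 rho^3 / r, so the exponent -1/6 cancels the r^2 terms and leaves - rho^3 / (r
   w). *)
transitivity (k * (36 * rho ^+ 3 / (r * (4 * (r ^+ 3 + rho ^+ 3) ^+ 2 - 9 * x ^+ 2))) * 0).
  by rewrite -ode; field; apply/andP.
by rewrite mulr0.
Qed.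

End tricomi_riemann.

Section profile_continuity.
Variables (R : realType) (T : topologicalType).
Implicit Types (f g w n : T -> R) (p : T).

Lemma continuous_mul p f g : {for p, continuous f} -> {for p, continuous g} ->
  {for p, continuous (fun q => f q * g q)}.
Proof. by move=> cf cg; apply: cvgM. Qed.

Lemma continuous_add p f g : {for p, continuous f} -> {for p, continuous g} ->
  {for p, continuous (fun q => f q + g q)}.
Proof. by move=> cf cg; apply: cvgD. Qed.

Lemma continuous_sub p f g : {for p, continuous f} -> {for p, continuous g} ->
  {for p, continuous (fun q => f q - g q)}.
Proof. by move=> cf cg; apply: cvgB. Qed.

Lemma continuous_const p (c : R) : {for p, continuous (fun=> c : R)}.
Proof. exact: cst_continuous. Qed.

Lemma continuous_div p f g : g p != 0 -> {for p, continuous f} ->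
  {for p, continuous g} -> {for p, continuous (fun q => f q / g q)}.
Proof. by move=> g0 cf cg; apply: cvgM => //; apply: cvgV. Qed.

Lemma continuous_expr p f k : {for p, continuous f} ->
  {for p, continuous (fun q => f q ^+ k)}.
Proof.
move=> cf; apply: (continuous_comp (g := fun z : R => z ^+ k)) => //.
exact: exprn_continuous.
Qed.

Lemma continuous_chain p f (h : R -> R) : {for p, continuous f} ->
  {for f p, continuous h} -> {for p, continuous (fun q => h (f q))}.
Proof. by move=> cf ch; apply: (continuous_comp (g := h)). Qed.

Lemma continuous_powR p f a : 0 < f p -> {for p, continuous f} ->
  {for p, continuous (fun q => f q `^ a)}.
Proof.
move=> f0 cf; apply: (continuous_chain (h := fun z : R => z `^ a)) => //.
apply: differentiable_continuous; apply/derivable1_diffP.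
exact: (is_derive1_powR a f0).(ex_derive).
Qed.

Section at_a_point.
Variables (p : T) (w w1 w2 n n1 n2 : T -> R).
Hypotheses (w0 : 0 < w p) (nw : `|n p| < w p).
Hypotheses (cw : {for p, continuous w}) (cw1 : {for p, continuous w1})
  (cw2 : {for p, continuous w2}) (cn : {for p, continuous n})
  (cn1 : {for p, continuous n1}) (cn2 : {for p, continuous n2}).

Let wn0 : w p != 0. Proof. by rewrite gt_eqF. Qed.

Let z1 : `|n p / w p| < 1.
Proof. by rewrite normf_div (gtr0_norm w0) ltr_pdivrMr// mul1r. Qed.

Let cz : {for p, continuous (fun q => n q / w q)}.
Proof. exact: continuous_div. Qed.

Let cF : {for p, continuous (fun q => hyperF (n q / w q))}.
Proof. exact: (continuous_chain cz (continuous_hyperF z1)). Qed.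

Let cF1 : {for p, continuous (fun q => hyperF1 (n q / w q))}.
Proof. exact: (continuous_chain cz (continuous_hyperF1 z1)). Qed.

Let cF2 : {for p, continuous (fun q => hyperF2 (n q / w q))}.
Proof. exact: (continuous_chain cz (continuous_hyperF2 z1)). Qed.

Let cl : {for p, continuous (fun q => w1 q / w q)}.
Proof. exact: continuous_div. Qed.

Let cl2 : {for p, continuous (fun q => w2 q / w q)}.
Proof. exact: continuous_div. Qed.

Let cz1 : {for p, continuous (fun q => zeta1 (w q) (w1 q) (n q) (n1 q))}.
Proof.
by apply: continuous_div => //; apply: continuous_sub => //; apply: continuous_mul.
Qed.

Let cz2 : {for p, continuous
  (fun q => zeta2 (w q) (w1 q) (w2 q) (n q) (n1 q) (n2 q))}.
Proof.
apply: continuous_div => //; apply: continuous_sub; last exact: continuous_mul.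
apply: continuous_sub => //; apply: continuous_mul => //.
by apply: continuous_mul => //; exact: continuous_const.
Qed.

Lemma continuous_profile : {for p, continuous (fun q => profile (w q) (n q))}.
Proof. by apply: continuous_mul => //; exact: continuous_powR. Qed.

Lemma continuous_profile1 :
  {for p, continuous (fun q => profile1 (w q) (w1 q) (n q) (n1 q))}.
Proof.
apply: continuous_mul; first exact: continuous_powR.
apply: continuous_sub; first exact: continuous_mul.
apply: continuous_mul => //; apply: continuous_mul => //; exact: continuous_const.
Qed.

Lemma continuous_profile2 : {for p, continuous
  (fun q => profile2 (w q) (w1 q) (w2 q) (n q) (n1 q) (n2 q))}.
Proof.
apply: continuous_mul; first exact: continuous_powR.
apply: continuous_add; first apply: continuous_add.
- by apply: continuous_mul => //; exact: continuous_expr.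
- apply: continuous_mul => //; apply: continuous_sub => //.
  apply: continuous_mul => //; apply: continuous_mul => //; exact: continuous_const.
- apply: continuous_mul => //; apply: continuous_sub.
    apply: continuous_mul; [exact: continuous_const|exact: continuous_expr].
  by apply: continuous_mul => //; exact: continuous_const.
Qed.

End at_a_point.
End profile_continuity.

Section riemann_continuity.
Variables (R : realType) (b : R).
Implicit Types p : R * R.

Lemma continuous_fst2 p : {for p, continuous (fun q : R * R => q.1)}.
Proof. exact: cvg_fst. Qed.

Lemma continuous_snd2 p : {for p, continuous (fun q : R * R => q.2)}.
Proof. exact: cvg_snd. Qed.

Lemma continuous_sqrt_opp p : {for p, continuous (fun q : R * R => sqrt_opp q.2)}.
Proof.
apply: (continuous_chain (h := Num.sqrt)); last exact: sqrt_continuous.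
by apply: continuousN; exact: continuous_snd2.
Qed.

Lemma continuous_sqrt_opp3 p (c : R) : {for p, continuous (fun q : R * R =>
  sqrt_opp q.2 ^+ 3 + c)}.
Proof.
apply: continuous_add; last exact: continuous_const.
by apply: continuous_expr; exact: continuous_sqrt_opp.
Qed.

Lemma continuous_coneW p : {for p, continuous (coneW b)}.
Proof.
rewrite /coneW; apply: continuous_sub; apply: continuous_mul; try exact: continuous_const.
  by apply: continuous_expr; exact: continuous_sqrt_opp3.
by apply: continuous_expr; exact: continuous_fst2.
Qed.

Lemma continuous_coneN p : {for p, continuous (coneN b)}.
Proof.
rewrite /coneN; apply: continuous_sub; apply: continuous_mul; try exact: continuous_const.
  by apply: continuous_expr; exact: continuous_sqrt_opp3.
by apply: continuous_expr; exact: continuous_fst2.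
Qed.

Lemma continuous_cone_x p : {for p, continuous (@cone_x R)}.
Proof.
by rewrite /cone_x; apply: continuous_mul; [exact: continuous_const|exact: continuous_fst2].
Qed.

Lemma continuous_coneW_y p : {for p, continuous (coneW_y b)}.
Proof.
rewrite /coneW_y; apply: continuous_mul; first exact: continuous_const.
by apply: continuous_mul; [exact: continuous_sqrt_opp|exact: continuous_sqrt_opp3].
Qed.

Lemma continuous_coneN_y p : {for p, continuous (coneN_y b)}.
Proof.
rewrite /coneN_y; apply: continuous_mul; first exact: continuous_const.
by apply: continuous_mul; [exact: continuous_sqrt_opp|exact: continuous_sqrt_opp3].
Qed.

Lemma continuous_coneW_yy p : p.2 < 0 -> {for p, continuous (coneW_yy b)}.
Proof.
move=> p0; rewrite /coneW_yy; apply: continuous_add; apply: continuous_mul;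
  try exact: continuous_const.
  by apply: continuous_expr; exact: continuous_sqrt_opp.
apply: continuous_div; [|exact: continuous_const|exact: continuous_sqrt_opp].
by rewrite gt_eqF// sqrt_opp_gt0.
Qed.

Lemma continuous_coneN_yy p : p.2 < 0 -> {for p, continuous (coneN_yy b)}.
Proof.
move=> p0; rewrite /coneN_yy; apply: continuous_sub; apply: continuous_mul;
  try exact: continuous_const.
  by apply: continuous_expr; exact: continuous_sqrt_opp.
apply: continuous_div; [|exact: continuous_const|exact: continuous_sqrt_opp].
by rewrite gt_eqF// sqrt_opp_gt0.
Qed.

Lemma open_lt_continuous (f g : R * R -> R) : continuous f -> continuous g ->
  open [set p | f p < g p].
Proof.
move=> cf cg; have -> : [set p | f p < g p] = (fun p => g p - f p) @^-1` [set z | 0 < z].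
  by apply/seteqP; split => p /=; rewrite subr_gt0.
apply: open_comp; last exact: open_gt.
by move=> p _; apply: continuous_sub; [exact: cg|exact: cf].
Qed.

Lemma open_riemann_dom : open (riemann_dom b).
Proof.
have -> : riemann_dom b = [set p | p.2 < 0] `&` [set p | `|coneN b p| < coneW b p] by [].
apply: openI; apply: open_lt_continuous.
- by move=> p; exact: continuous_snd2.
- by move=> p; exact: continuous_const.
- move=> p; apply: (continuous_chain (h := Num.norm)); last exact: norm_continuous.
  exact: continuous_coneN.
- by move=> p; exact: continuous_coneW.
Qed.

Lemma continuous_riemann p : riemann_dom b p -> {for p, continuous (riemann b)}.
Proof.
move=> D; apply: continuous_profile; [exact: riemann_dom_W|exact: D.2|exact: continuous_coneW|].
exact: continuous_coneN.
Qed.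

Lemma continuous_riemann_x p : riemann_dom b p -> {for p, continuous (riemann_x b)}.
Proof.
move=> D; apply: continuous_profile1; [exact: riemann_dom_W|exact: D.2|exact: continuous_coneW|
 exact: continuous_cone_x|exact: continuous_coneN|exact: continuous_cone_x].
Qed.

Lemma continuous_riemann_y p : riemann_dom b p -> {for p, continuous (riemann_y b)}.
Proof.
move=> D; apply: continuous_profile1; [exact: riemann_dom_W|exact: D.2|exact: continuous_coneW|
 exact: continuous_coneW_y|exact: continuous_coneN|exact: continuous_coneN_y].
Qed.

Lemma continuous_riemann_xx p : riemann_dom b p -> {for p, continuous (riemann_xx b)}.
Proof.
move=> D; apply: continuous_profile2; [exact: riemann_dom_W|exact: D.2|exact: continuous_coneW|
 exact: continuous_cone_x|exact: continuous_const|exact: continuous_coneN|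
 exact: continuous_cone_x|exact: continuous_const].
Qed.

Lemma continuous_riemann_yy p : riemann_dom b p -> {for p, continuous (riemann_yy b)}.
Proof.
move=> D; apply: continuous_profile2; [exact: riemann_dom_W|exact: D.2|exact: continuous_coneW|
 exact: continuous_coneW_y|exact: continuous_coneW_yy D.1|exact: continuous_coneN|
 exact: continuous_coneN_y|exact: continuous_coneN_yy D.1].
Qed.

End riemann_continuity.

(** * Fubini's theorem and the fundamental theorem of calculus *)

Section fubini_ftc.
Variable R : realType.
Local Notation mu := (@lebesgue_measure R).

Lemma integral_ysections (S : set (R * R)) (f : R * R -> R) :
  measurable (S : set (plane R)) -> (lebesgue2 R).-integrable S (EFin \o f) ->
  (\int[lebesgue2 R]_(p in S) (f p)%:E =
   \int[mu]_y \int[mu]_(x in [set x | S (x, y)]) (f (x, y))%:E)%E.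
Proof.
move=> mS /(integrable_mkcond _ mS) intS; rewrite integral_mkcond.
rewrite -[LHS](integral21_prod_meas1 intS); apply: eq_integral => y _.
rewrite [RHS]integral_mkcond; apply: eq_integral => x _.
by rewrite !patchE; congr (if _ then _ else _); apply/idP/idP; rewrite !inE.
Qed.

Lemma integral_xsections (S : set (R * R)) (f : R * R -> R) :
  measurable (S : set (plane R)) -> (lebesgue2 R).-integrable S (EFin \o f) ->
  (\int[lebesgue2 R]_(p in S) (f p)%:E =
   \int[mu]_x \int[mu]_(y in [set y | S (x, y)]) (f (x, y))%:E)%E.
Proof.
move=> mS /(integrable_mkcond _ mS) intS; rewrite integral_mkcond.
rewrite -[LHS](integral12_prod_meas1 intS); apply: eq_integral => x _.
rewrite [RHS]integral_mkcond; apply: eq_integral => y _.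
by rewrite !patchE; congr (if _ then _ else _); apply/idP/idP; rewrite !inE.
Qed.

Lemma within_itv_continuous (f : R -> R) (a c : R) :
  (forall x, a <= x <= c -> {for x, continuous f}) -> {within `[a, c], continuous f}.
Proof.
move=> cf; apply: continuous_in_subspaceT => x; rewrite inE/= in_itv/= => /cf.
exact.
Qed.

Lemma continuous_is_derive (F : R -> R) (x d : R) :
  is_derive x (1 : R) F d -> {for x, continuous F}.
Proof.
move=> dF; apply: differentiable_continuous; apply/derivable1_diffP.
exact: dF.(ex_derive).
Qed.

Lemma is_derive_LRcontinuous (F f : R -> R) (a c : R) :
  (forall x, a <= x <= c -> is_derive x (1 : R) F (f x)) -> a <= c ->
  derivable_oo_LRcontinuous F a c.
Proof.
move=> dF ac; split.
- by move=> x; rewrite in_itv/= => /andP[? ?]; apply: (dF x _).(ex_derive); rewrite !ltW.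
- by apply: cvg_at_right_filter; apply: continuous_is_derive (dF a _); rewrite lexx.
- by apply: cvg_at_left_filter; apply: continuous_is_derive (dF c _); rewrite lexx andbT.
Qed.

Lemma is_derive_derive1 (F f : R -> R) (a c : R) :
  (forall x, a <= x <= c -> is_derive x (1 : R) F (f x)) ->
  {in `]a, c[, F^`()%classic =1 f}.
Proof.
move=> dF x; rewrite in_itv/= => /andP[ax xc].
by rewrite derive1E; apply: (dF x _).(derive_val); rewrite !ltW.
Qed.

Lemma integral_FTC (F f : R -> R) (a c : R) : a <= c ->
  (forall x, a <= x <= c -> is_derive x (1 : R) F (f x)) ->
  (forall x, a <= x <= c -> {for x, continuous f}) ->
  (\int[mu]_(x in `[a, c]) (f x)%:E = (F c - F a)%:E)%E.
Proof.
rewrite le_eqVlt => /predU1P[-> _ _|ac dF cf].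
  by rewrite set_itv1 integral_set1 subrr.
rewrite EFinB; apply: continuous_FTC2 => //.
- exact: within_itv_continuous.
- exact: is_derive_LRcontinuous dF (ltW ac).
- exact: is_derive_derive1.
Qed.

Lemma measurable_itv_continuous (f : R -> R) (a c : R) :
  (forall x, a <= x <= c -> {for x, continuous f}) ->
  measurable_fun (`[a, c]%classic : set (measurableTypeR R)) f.
Proof.
move=> cf; apply: subspace_continuous_measurable_fun; first exact: measurable_itv.
exact: within_itv_continuous.
Qed.

(** The sections of the open triangle are open intervals, whereas the fundamental theorem of
    calculus is applied on closed ones. *)
Lemma integral_oo_cc (f : R -> R) (a c : R) :
  (forall x, a <= x <= c -> {for x, continuous f}) ->
  (\int[mu]_(x in `]a, c[) (f x)%:E = \int[mu]_(x in `[a, c]) (f x)%:E)%E.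
Proof.
move=> cf; apply/esym/integral_itv_bndoo; apply/measurable_EFinP.
apply: measurable_funS (measurable_itv_continuous cf) => //.
by move=> x /=; rewrite !in_itv/= => /andP[? ?]; rewrite !ltW.
Qed.

Lemma integral_FTC_oo (F f : R -> R) (a c : R) : a <= c ->
  (forall x, a <= x <= c -> is_derive x (1 : R) F (f x)) ->
  (forall x, a <= x <= c -> {for x, continuous f}) ->
  (\int[mu]_(x in `]a, c[) (f x)%:E = (F c - F a)%:E)%E.
Proof. by move=> ac dF cf; rewrite integral_oo_cc//; exact: integral_FTC. Qed.

Lemma continuous_itv_integrable (f : R -> R) (a c : R) :
  (forall x, a <= x <= c -> {for x, continuous f}) ->
  mu.-integrable `[a, c] (EFin \o f).
Proof.
move=> cf; apply: continuous_compact_integrable; first exact: segment_compact.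
exact: within_itv_continuous.
Qed.

Section substitution.
Variables (F f G : R -> R) (a c : R).
Hypothesis ac : a <= c.
Hypothesis dF : forall x, a <= x <= c -> \forall z \near x, is_derive z (1 : R) F (f z).
Hypothesis cf : forall x, a <= x <= c -> {for x, continuous f}.

Let dF' x : a <= x <= c -> is_derive x (1 : R) F (f x).
Proof. by move=> /dF; exact: nbhs_singleton. Qed.

(** The derivative is given near every point, endpoints included; hence the derivative function
    agrees with f near the endpoints and inherits its one-sided limits there. *)
Let F'E x : a <= x <= c -> \forall z \near x, f z = F^`()%classic z.
Proof.
by move=> /dF; apply: filterS => z dz; rewrite derive1E; apply/esym/dz.(derive_val).
Qed.

Let cF' x : a <= x <= c -> {for x, continuous F^`()%classic}.
Proof.
move=> xac; rewrite /prop_for /continuous_at -(nbhs_singleton (F'E xac)).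
exact: cvg_trans (near_eq_cvg (F'E xac)) (cf xac).
Qed.

Let cF'oo : {in `]a, c[, continuous F^`()%classic}.
Proof. by move=> x; rewrite in_itv/= => /andP[? ?]; apply: cF'; rewrite !ltW. Qed.

Let cF'a : cvg (F^`()%classic x @[x --> a^'+]).
Proof. by apply: cvgP; apply: cvg_at_right_filter; apply: cF'; rewrite lexx. Qed.

Let cF'c : cvg (F^`()%classic x @[x --> c^'-]).
Proof. by apply: cvgP; apply: cvg_at_left_filter; apply: cF'; rewrite lexx andbT. Qed.

Lemma integral_substitution_decr :
  (forall x y, a <= x <= c -> a <= y <= c -> x < y -> F y < F x) ->
  (forall x, F c <= x <= F a -> {for x, continuous G}) ->
  (\int[mu]_(x in `[F c, F a]) (G x)%:E =
   \int[mu]_(x in `[a, c]) (G (F x) * - f x)%:E)%E.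
Proof.
move=> decr cG; have mono : {in `[a, c] &, {homo F : x y /~ (x < y)%R}}.
  by move=> x y; rewrite !in_itv/= => ? ?; exact: decr.
rewrite (integration_by_substitution_decreasing ac mono cF'oo cF'a cF'c
  (is_derive_LRcontinuous dF' ac) (within_itv_continuous cG)).
apply: eq_integral => x; rewrite inE/= in_itv/= => xac.
by congr (_ * - _)%:E; rewrite (nbhs_singleton (F'E xac)).
Qed.

Lemma integral_substitution_incr :
  (forall x y, a <= x <= c -> a <= y <= c -> x < y -> F x < F y) ->
  (forall x, F a <= x <= F c -> {for x, continuous G}) ->
  (\int[mu]_(x in `[F a, F c]) (G x)%:E =
   \int[mu]_(x in `[a, c]) (G (F x) * f x)%:E)%E.
Proof.
move=> incr cG; have mono : {in `[a, c] &, {homo F : x y / (x < y)%R}}.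
  by move=> x y; rewrite !in_itv/= => ? ?; exact: incr.
rewrite (integration_by_substitution_increasing ac mono cF'oo cF'a cF'c
  (is_derive_LRcontinuous dF' ac) (within_itv_continuous cG)).
apply: eq_integral => x; rewrite inE/= in_itv/= => xac.
by congr (_ * _)%:E; rewrite (nbhs_singleton (F'E xac)).
Qed.

End substitution.
End fubini_ftc.

(** * Green's formula on a characteristic triangle *)

Section chain_rule.
Variables (R : realType) (phi phix : R * R -> R).
Hypothesis dx : forall x y, is_derive x (1 : R) (fun s => phi (s, y)) (phix (x, y)).
Hypothesis cx : continuous phix.

Let mvt x0 x y : exists xi : R, `|xi - x0| <= `|x - x0| /\
  phi (x, y) - phi (x0, y) = phix (xi, y) * (x - x0).
Proof.
wlog suff mvtle : x0 x / x0 <= x -> exists xi : R, (x0 <= xi <= x) /\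
    phi (x, y) - phi (x0, y) = phix (xi, y) * (x - x0).
  have [|xx0] := leP x0 x.
    move=> /[dup] xx0 /mvtle[xi [/andP[? ?] E]]; exists xi; split => //.
    by rewrite !ger0_norm ?subr_ge0// lerD2r.
  have /mvtle[xi [/andP[? ?] E]] := ltW xx0; exists xi; split.
    by rewrite !ler0_norm ?subr_le0 ?(ltW xx0)// lerN2 lerD2r.
  by rewrite -opprB E -mulrN opprB.
move=> xx0.
have cphi : {within `[x0, x], continuous (fun s => phi (s, y))}.
  by apply: within_itv_continuous => s _; exact: continuous_is_derive (dx s y).
have [xi] := MVT_segment (df := fun s => phix (s, y)) xx0 (fun s _ => dx s y) cphi.
by rewrite in_itv/= => ? ?; exists xi.
Qed.

(** No joint differentiability is assumed. The increment splits into phi (a z, z) - phi (a t, z),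
    handled by the mean value theorem in x and the continuity of [phix], and phi (a t, z) - phi (a
    t, t), handled by the partial derivative in y at the single point (a t, t). *)
Lemma is_derive_along_curve (a : R -> R) (t a' d : R) :
  is_derive t (1 : R) a a' ->
  is_derive t (1 : R) (fun s => phi (a t, s)) d ->
  is_derive t (1 : R) (fun s => phi (a s, s)) (phix (a t, t) * a' + d).
Proof.
move=> da; have ca := continuous_is_derive da.
move: da => /is_derive1_caratheodory[ga [gaE cga ga']].
move=> /is_derive1_caratheodory[gp [gpE cgp gp']].
apply/is_derive1_caratheodory.
pose xi z := projT1 (cid (mvt (a t) (a z) z)).
have xiP z : `|xi z - a t| <= `|a z - a t| /\
  phi (a z, z) - phi (a t, z) = phix (xi z, z) * (a z - a t).
  by rewrite /xi; case: cid.
(* The Caratheodory slope of the composite, [xi z] being a mean value point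
   between [a t] and [a z]. *)
exists (fun z => phix (xi z, z) * ga z + gp z).
have xit : xi t = a t.
  by apply/eqP; rewrite -subr_eq0 -normr_le0; have [] := xiP t; rewrite subrr normr0.
split; last by rewrite xit ga' gp'.
- by move=> z; rewrite mulrDl -gpE -mulrA -gaE -(xiP z).2 addrA subrK.
apply: continuous_add => //; apply: continuous_mul => //.
(* The mean value point is squeezed, being no farther from a t than a z is. *)
have cxi : xi z @[z --> t] --> a t.
  apply/cvgrPdist_lt => e e0; near=> z; rewrite distrC.
  apply: le_lt_trans (xiP z).1 _; rewrite distrC; near: z.
  by move/cvgrPdist_lt : ca; apply.
rewrite /prop_for /continuous_at xit.
apply: (@cvg_comp _ _ _ (fun z => (xi z, z)) phix _ (nbhs (a t, t))); last exact: cx.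
by apply: (cvg_pair (G := nbhs (a t)) (H := nbhs t)) => //; exact: cvg_id.
Unshelve. all: by end_near. Qed.

End chain_rule.

(** * The cone bounded by the two characteristics *)

Section characteristic_triangle.
Variables (R : realType) (b : R).
Hypothesis b0 : b < 0.
Let rho := sqrt_opp b.

(* [|x| < half_width y] is the section of the cone at height [y]; its slope is
   [- sqrt (- y)], so that its edges are characteristics. *)
Definition half_width (y : R) : R := 2 / 3 * (sqrt_opp y ^+ 3 - rho ^+ 3).

(** Solves x = 2/3 (r^3 - rho^3) for r and returns y = - r^2; it is the inverse of [half_width] for
    x >= 0. *)
Definition half_width_inv (x : R) : R := - ((3 / 2 * x + rho ^+ 3) `^ 3^-1) ^+ 2.

Lemma rho_gt0 : 0 < rho. Proof. exact: sqrt_opp_gt0. Qed.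

Lemma sqrt_opp_ge0 (y : R) : 0 <= sqrt_opp y. Proof. exact: sqrtr_ge0. Qed.

Lemma coneNE (p : R * R) : coneN b p = 9 * (half_width p.2 ^+ 2 - p.1 ^+ 2).
Proof. by rewrite /coneN /half_width -/rho; field. Qed.

(** The gap w - n is positive wherever y < 0, which keeps n / w strictly below 1 up to the edges. *)
Lemma coneWE (p : R * R) : coneW b p = coneN b p + 16 * (sqrt_opp p.2 ^+ 3 * rho ^+ 3).
Proof. by rewrite /coneN /coneW -/rho; ring. Qed.

Lemma is_derive_half_width (y : R) : y < 0 -> is_derive y (1 : R) half_width (- sqrt_opp y).
Proof.
move=> y0; have r0 : sqrt_opp y != 0 by rewrite gt_eqF// sqrt_opp_gt0.
apply: is_derive_eq (is_derive_scale (2 / 3) (is_derive_sub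
  (is_derive_expr 3 (is_derive_sqrt_opp y0)) (is_derive_const y (rho ^+ 3)))) _.
by rewrite /=; field.
Qed.

Lemma sqrt_opp_decr (y z : R) : y < 0 -> y < z -> sqrt_opp z < sqrt_opp y.
Proof. by move=> y0 yz; rewrite ltr_sqrt ?oppr_gt0// ltrN2. Qed.

Lemma half_width_decr (y z : R) : y < 0 -> y < z -> half_width z < half_width y.
Proof.
move=> y0 yz; rewrite /half_width ltr_pM2l; last by lra.
by rewrite ltrD2r ltrXn2r//; [exact: sqrt_opp_ge0|exact: sqrt_opp_decr].
Qed.

Lemma half_width_b : half_width b = 0. Proof. by rewrite /half_width subrr mulr0. Qed.

Lemma half_width_ge0 (y : R) : y <= b -> 0 <= half_width y.
Proof.
rewrite le_eqVlt => /predU1P[->|yb]; first by rewrite half_width_b.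
by rewrite -half_width_b ltW// half_width_decr// (lt_trans yb).
Qed.

Lemma sqrt_opp_half_width_inv (x : R) : 0 <= x ->
  sqrt_opp (half_width_inv x) = (3 / 2 * x + rho ^+ 3) `^ 3^-1.
Proof. by move=> x0; rewrite /sqrt_opp /half_width_inv opprK sqrtr_sqr ger0_norm//
  powR_ge0. Qed.

Lemma half_widthK (x : R) : 0 <= x -> half_width (half_width_inv x) = x.
Proof.
move=> x0; rewrite /half_width sqrt_opp_half_width_inv// -powR_mulrn ?powR_ge0// -powRrM
  mulVf ?pnatr_eq0//.
rewrite powRr1; first by field.
have := exprn_ge0 3 (ltW rho_gt0); lra.
Qed.

Lemma half_width_inv_lt0 (x : R) : 0 <= x -> half_width_inv x < 0.
Proof.
move=> x0; rewrite oppr_lt0 exprn_gt0// powR_gt0//.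
have := exprn_gt0 3 rho_gt0; lra.
Qed.

Lemma half_width_inj (y z : R) : y < 0 -> z < 0 -> half_width y = half_width z -> y = z.
Proof.
move=> y0 z0 E; apply/eqP; case: ltgtP => // [/(half_width_decr y0)|/(half_width_decr z0)];
  rewrite E ltxx//.
Qed.

Lemma hinv_half_width (y : R) : y <= b -> half_width_inv (half_width y) = y.
Proof.
move=> yb; have h0 := half_width_ge0 yb; have y0 : y < 0 by exact: le_lt_trans b0.
by apply: half_width_inj => //; [exact: half_width_inv_lt0|exact: half_widthK].
Qed.

Lemma ltr_half_width_inv (x y : R) :
  0 <= x -> y < 0 -> (x < half_width y) = (y < half_width_inv x).
Proof.
move=> x0 y0; have h0 := half_width_inv_lt0 x0.
have [yh|hy|E] := ltgtP y (half_width_inv x).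
- by rewrite -[ltLHS](half_widthK x0) half_width_decr.
- by rewrite -[ltLHS](half_widthK x0) ltNge (ltW (half_width_decr h0 hy)).
- by rewrite E half_widthK// ltxx.
Qed.

Lemma continuous_half_width_inv (x : R) : 0 <= x -> {for x, continuous half_width_inv}.
Proof.
move=> x0; apply: continuousN; apply: continuous_expr; apply: continuous_powR.
  have := exprn_gt0 3 rho_gt0; lra.
apply: continuous_add; last exact: continuous_const.
by apply: continuous_mul; [exact: continuous_const|exact: cvg_id].
Qed.

Lemma continuous_half_width2 (p : R * R) : {for p, continuous (fun q : R * R =>
  half_width q.2)}.
Proof.
by apply: continuous_mul; [exact: continuous_const|exact: continuous_sqrt_opp3].
Qed.

Lemma cone_riemann_dom (p : R * R) : p.2 <= b -> `|p.1| <= half_width p.2 -> riemann_dom b p.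
Proof.
move=> pb ph; have p0 : p.2 < 0 by exact: le_lt_trans b0.
split => //; have N0 : 0 <= coneN b p.
  by rewrite coneNE mulr_ge0// subr_ge0 -[leLHS]real_normK ?num_real// lerXn2r ?nnegrE//
    half_width_ge0.
rewrite ger0_norm// coneWE ltrDl; apply: mulr_gt0 => //.
by rewrite mulr_gt0// exprn_gt0 ?rho_gt0// sqrt_opp_gt0.
Qed.

Lemma powR32 (y : R) : y < 0 -> (- y) `^ (3 / 2) = sqrt_opp y ^+ 3.
Proof.
move=> y0; have Ny : 0 <= - y by rewrite oppr_ge0 ltW.
by rewrite mulrC powRrM powR12_sqrt// powR_mulrn// sqrtr_ge0.
Qed.

Lemma tricomi_aE : tricomi_a b = 2 / 3 * rho ^+ 3.
Proof. by rewrite /tricomi_a powR32. Qed.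

Lemma tricomi_uE (p : R * R) : p.2 < 0 -> tricomi_u b p = - coneN b p.
Proof.
move=> p0; rewrite /tricomi_u powR32// tricomi_aE /coneN -/rho.
have -> : p.2 ^+ 3 = - (sqrt_opp p.2 ^+ 3) ^+ 2.
  by rewrite -exprM mulnC exprM sqrt_opp_sqr//; ring.
by field.
Qed.

Lemma tricomi_vE (p : R * R) : p.2 < 0 -> tricomi_v b p = - coneW b p.
Proof.
move=> p0; rewrite /tricomi_v powR32// tricomi_aE /coneW -/rho.
have -> : p.2 ^+ 3 = - (sqrt_opp p.2 ^+ 3) ^+ 2.
  by rewrite -exprM mulnC exprM sqrt_opp_sqr//; ring.
by field.
Qed.

(** Here - u = n = 9 (h^2 - x^2) with h the half-width, and h >= 0 for y <= b. *)
Lemma D_minusE (p : R * R) : D_minus b p <-> p.2 < b /\ `|p.1| < half_width p.2.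
Proof.
rewrite /D_minus/=; split=> -[pb]; have p0 := lt_trans pb b0;
  have h0 := half_width_ge0 (ltW pb).
  rewrite tricomi_uE// coneNE oppr_lt0 pmulr_rgt0// subr_gt0 => H; split => //.
  by rewrite -(ltr_pXn2r (n := 2))// ?nnegrE// real_normK ?num_real.
move=> H; split => //; rewrite tricomi_uE// coneNE oppr_lt0 pmulr_rgt0// subr_gt0.
by rewrite -[ltLHS]real_normK ?num_real// ltrXn2r.
Qed.

Lemma E_minusE (p : R * R) : D_minus b p -> E_minus b p = riemann b p / 2 `^ (1 / 3).
Proof.
move=> D; have p0 := lt_trans D.1 b0.
rewrite /E_minus mem_set// tricomi_uE// tricomi_vE// hypergeometric_sixthE.
by rewrite opprK invrN mulrNN mulrAC.
Qed.

End characteristic_triangle.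

(** * Integration of the divergence over the truncated cone *)

Section green.
Variables (R : realType) (b y0 : R).
Hypotheses (b0 : b < 0) (y0b : y0 < b).
Variables phi phix phixx phiy phiyy : R * R -> R.
Hypothesis dphix : forall x y, is_derive x (1 : R) (fun s => phi (s, y)) (phix (x, y)).
Hypothesis dphixx : forall x y, is_derive x (1 : R) (fun s => phix (s, y)) (phixx (x, y)).
Hypothesis dphiy : forall x y, is_derive y (1 : R) (fun s => phi (x, s)) (phiy (x, y)).
Hypothesis dphiyy : forall x y, is_derive y (1 : R) (fun s => phiy (x, s)) (phiyy (x, y)).
Hypotheses (cphi : forall p, {for p, continuous phi})
  (cphix : forall p, {for p, continuous phix})
  (cphixx : forall p, {for p, continuous phixx})
  (cphiy : forall p, {for p, continuous phiy})
  (cphiyy : forall p, {for p, continuous phiyy}).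
(* In the application [phi] vanishes near and below the line [y = y0]. *)
Hypotheses (phi_y0 : forall x, phi (x, y0) = 0) (phiy_y0 : forall x, phiy (x, y0) = 0).

Local Notation mu := (@lebesgue_measure R).
Local Notation h := (half_width b).
Let rho := sqrt_opp b.
Let G := riemann b.

Definition triangle : set (R * R) := [set p | (y0 < p.2 < b) /\ `|p.1| < h p.2].
(** The closed triangle: a compact subset of [riemann_dom], on which the integrands are bounded. *)
Let K : set (R * R) := [set p | (y0 <= p.2 <= b) /\ `|p.1| <= h p.2].

(** (P, Q) is the flux field, and A, B are P_x and Q_y: the products G_x phi_x and G_y phi_y cancel
    in each derivative. *)
Let P p := p.2 * (G p * phix p - riemann_x b p * phi p).
Let A p := p.2 * (G p * phixx p - riemann_xx b p * phi p).
Let Q p := G p * phiy p - riemann_y b p * phi p.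
Let B p := G p * phiyy p - riemann_yy b p * phi p.

Lemma flux_divergence p : riemann_dom b p ->
  A p + B p = G p * (p.2 * phixx p + phiyy p).
Proof.
move=> /tricomi_riemann E.
transitivity (G p * (p.2 * phixx p + phiyy p)
    - phi p * (p.2 * riemann_xx b p + riemann_yy b p)); first by rewrite /A /B; ring.
by rewrite E mulr0 subr0.
Qed.

Let dP x y : riemann_dom b (x, y) -> is_derive x (1 : R) (fun s => P (s, y)) (A (x, y)).
Proof.
move=> D; apply: is_derive_eq (is_derive_scale y (is_derive_sub
  (is_derive_mul (is_derive_riemann_x D) (dphixx x y))
  (is_derive_mul (is_derive_riemann_xx D) (dphix x y)))) _.
by rewrite /A /G /=; ring.
Qed.

Let dQ x y : riemann_dom b (x, y) -> is_derive y (1 : R) (fun s => Q (x, s)) (B (x, y)).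
Proof.
move=> D; apply: is_derive_eq (is_derive_sub
  (is_derive_mul (is_derive_riemann_y D) (dphiyy x y))
  (is_derive_mul (is_derive_riemann_yy D) (dphiy x y))) _.
by rewrite /B /G /=; ring.
Qed.

Let cP p : riemann_dom b p -> {for p, continuous P}.
Proof.
move=> D; apply: continuous_mul; first exact: continuous_snd2.
apply: continuous_sub; apply: continuous_mul.
- exact: continuous_riemann.
- exact: cphix.
- exact: continuous_riemann_x.
- exact: cphi.
Qed.

Let cA p : riemann_dom b p -> {for p, continuous A}.
Proof.
move=> D; apply: continuous_mul; first exact: continuous_snd2.
apply: continuous_sub; apply: continuous_mul.
- exact: continuous_riemann.
- exact: cphixx.
- exact: continuous_riemann_xx.
- exact: cphi.
Qed.

Let cQ p : riemann_dom b p -> {for p, continuous Q}.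
Proof.
move=> D; apply: continuous_sub; apply: continuous_mul.
- exact: continuous_riemann.
- exact: cphiy.
- exact: continuous_riemann_y.
- exact: cphi.
Qed.

Let cB p : riemann_dom b p -> {for p, continuous B}.
Proof.
move=> D; apply: continuous_sub; apply: continuous_mul.
- exact: continuous_riemann.
- exact: cphiyy.
- exact: continuous_riemann_yy.
- exact: cphi.
Qed.

Let K_dom : K `<=` riemann_dom b.
Proof. by move=> p [/andP[_ pb] ph]; exact: cone_riemann_dom. Qed.

Lemma closed_le_continuous (f g : R * R -> R) :
  (forall p, {for p, continuous f}) -> (forall p, {for p, continuous g}) ->
  closed [set p | f p <= g p].
Proof.
move=> cf cg; have -> : [set p | f p <= g p] = ~` [set p | g p < f p].
  by apply/seteqP; split => p /=; rewrite leNgt => /negP.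
by apply: open_closedC; apply: open_lt_continuous => p; [exact: cg|exact: cf].
Qed.

Let compactK : compact K.
Proof.
have -> : K = [set p | `|p.1| <= Num.max (h y0) (- y0) /\ `|p.2| <= Num.max (h y0) (- y0)]
   `&` ([set p | y0 <= p.2] `&` [set p | p.2 <= b] `&` [set p | `|p.1| <= h p.2]).
  apply/seteqP; split => [p [/andP[yp pb] ph]|p [_ [[/= yp pb] ph]]]; last first.
    by split => //; apply/andP.
  have p0 : p.2 < 0 by exact: le_lt_trans b0.
  split=> //; split; rewrite le_max; apply/orP; [left|right].
    apply: le_trans ph _; move: yp; rewrite le_eqVlt => /predU1P[->//|yp].
    by rewrite ltW// half_width_decr// (lt_trans yp).
  by rewrite ler0_norm ?lerN2// ltW.
apply: compact_closedI; first exact: box_compact.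
apply: closedI; first apply: closedI; apply: closed_le_continuous => p.
- exact: continuous_const.
- exact: continuous_snd2.
- exact: continuous_snd2.
- exact: continuous_const.
- apply: (continuous_chain (h := Num.norm)); last exact: norm_continuous.
  exact: continuous_fst2.
- exact: continuous_half_width2.
Qed.

Let triangleK : triangle `<=` K.
Proof. by move=> p [/andP[? ?] ?]; split; [apply/andP; split|]; exact: ltW. Qed.

Lemma measurable_triangle : measurable (triangle : set (plane R)).
Proof.
have -> : triangle = [set p | y0 < p.2] `&` [set p | p.2 < b] `&` [set p | `|p.1| < h p.2].
  by apply/seteqP; split => [p [/andP[? ?] ?]|p [[/= ? ?] ?]]; split => //; apply/andP.
apply: open_measurable2; apply: openI; first apply: openI; apply: open_lt_continuous => p.
- exact: continuous_const.
- exact: continuous_snd2.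
- exact: continuous_snd2.
- exact: continuous_const.
- apply: (continuous_chain (h := Num.norm)); last exact: norm_continuous.
  exact: continuous_fst2.
- exact: continuous_half_width2.
Qed.

Lemma integrable_triangle (g : R * R -> R) :
  (forall p, riemann_dom b p -> {for p, continuous g}) ->
  (lebesgue2 R).-integrable triangle (EFin \o g).
Proof.
move=> cg; have cg' : {in riemann_dom b, continuous g} by move=> p; rewrite inE => /cg.
exact: (continuous_in_integrable2 (@open_riemann_dom R b) cg' compactK K_dom
  measurable_triangle triangleK).
Qed.

Let edge_dom (s y : R) : y <= b -> `|s| <= 1 -> riemann_dom b (s * h y, y).
Proof.
move=> yb s1; apply: cone_riemann_dom => //=; rewrite normrM (ger0_norm (half_width_ge0 b0 yb)).
by rewrite ler_piMl// half_width_ge0.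
Qed.

Let continuous_edge (g : R * R -> R) (s y : R) : y <= b -> `|s| <= 1 ->
  (forall p, riemann_dom b p -> {for p, continuous g}) ->
  {for y, continuous (fun z => g (s * h z, z))}.
Proof.
move=> yb s1 cg; have y_lt0 : y < 0 by exact: le_lt_trans b0.
have csh : {for y, continuous (fun z => s * h z)}.
  apply: continuous_mul; first exact: continuous_const.
  exact: continuous_is_derive (is_derive_half_width b y_lt0).
apply: (@cvg_comp _ _ _ (fun z => (s * h z, z)) g _ (nbhs (s * h y, y))); last first.
  by apply: cg; exact: edge_dom.
by apply: (cvg_pair (G := nbhs (s * h y)) (H := nbhs y)); [exact: csh|exact: cvg_id].
Qed.

(** Horizontal sections are integrated out by the fundamental theorem of calculus. The factors 1 and
    -1 are kept so that both edges are instances of the curve x = s h(y). *)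
Lemma integral_x_flux : (\int[lebesgue2 R]_(p in triangle) (A p)%:E =
  \int[mu]_(y in `[y0, b]) (P (1 * h y, y) - P (-1 * h y, y))%:E)%E.
Proof.
rewrite (integral_ysections measurable_triangle (integrable_triangle cA)).
rewrite -integral_oo_cc; last first.
  move=> y /andP[_ yb].
  by apply: continuous_sub; apply: continuous_edge => //; rewrite ?normrN normr1.
rewrite [RHS]integral_mkcond; apply: eq_integral => y _; rewrite patchE.
case: ifPn => [|/negP]; rewrite inE /= in_itv /= => yy.
  have yb : y <= b by move/andP: yy => [_ /ltW].
  have -> : [set x | triangle (x, y)] = `]- h y, h y[%classic.
    by apply/seteqP; split => x /=; rewrite in_itv/= -ltr_norml /triangle/=; [case|].
  have dom x : - h y <= x <= h y -> riemann_dom b (x, y).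
    by rewrite -ler_norml => ?; exact: cone_riemann_dom.
  have le : - h y <= h y by rewrite ge0_cp// half_width_ge0.
  have dPy x : - h y <= x <= h y -> is_derive x (1 : R) (fun s => P (s, y)) (A (x, y)).
    by move=> /dom; exact: dP.
  have cAy x : - h y <= x <= h y -> {for x, continuous (fun s => A (s, y))}.
    move=> /dom D; apply: (@cvg_comp _ _ _ (fun z => (z, y)) A _ (nbhs (x, y))); last exact: cA.
    by apply: (cvg_pair (G := nbhs x) (H := nbhs y)); [exact: cvg_id|exact: cvg_cst].
  by rewrite (integral_FTC_oo le dPy cAy) mul1r mulN1r.
have -> : [set x | triangle (x, y)] = set0.
  by apply/seteqP; split => x //= [/= ].
exact: integral_set0.
Qed.

Let X := h y0.

Let y0_lt0 : y0 < 0. Proof. exact: lt_trans b0. Qed.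

Let X0 : 0 <= X. Proof. by apply: half_width_ge0 => //; exact: ltW. Qed.

Let half_width_inv_le_b x : 0 <= x -> half_width_inv b x <= b.
Proof.
by move=> x0; rewrite leNgt -(ltr_half_width_inv b0)// half_width_b -leNgt.
Qed.

(** Both edges as one graph over the x-axis, meeting at the vertex over x = 0; this is the upper end
    of the vertical sections. *)
Let top x : R * R := (x, half_width_inv b `|x|).

Let top_dom x : riemann_dom b (top x).
Proof.
apply: cone_riemann_dom => //=; first exact: half_width_inv_le_b.
by rewrite (half_widthK b0).
Qed.

Let continuous_top (g : R * R -> R) x :
  (forall p, riemann_dom b p -> {for p, continuous g}) ->
  {for x, continuous (fun z => g (top z))}.
Proof.
move=> cg.
apply: (@cvg_comp _ _ _ top g _ (nbhs (top x))); last exact: cg.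
apply: (cvg_pair (G := nbhs x) (H := nbhs (half_width_inv b `|x|))); first exact: cvg_id.
apply: (continuous_chain (f := Num.norm)); first exact: norm_continuous.
exact: continuous_half_width_inv.
Qed.

Lemma integral_y_flux : (\int[lebesgue2 R]_(p in triangle) (B p)%:E =
  \int[mu]_(x in `[(- X)%R, X]) (Q (top x))%:E)%E.
Proof.
rewrite (integral_xsections measurable_triangle (integrable_triangle cB)).
rewrite -integral_oo_cc; last by move=> x _; exact: continuous_top.
rewrite [RHS]integral_mkcond; apply: eq_integral => x _; rewrite patchE.
case: ifPn => [|/negP]; rewrite inE /= in_itv /= -ltr_norml => xX.
  have x0 := normr_ge0 x; have hb := half_width_inv_le_b x0;
    have h0 := half_width_inv_lt0 b0 x0.
  have yt : y0 <= half_width_inv b `|x| by rewrite ltW// -(ltr_half_width_inv b0).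
  have -> : [set y | triangle (x, y)] = `]y0, (half_width_inv b `|x|)[%classic.
    apply/seteqP; split => y /=; rewrite in_itv/= /triangle/=.
      by move=> [/andP[-> yb]]; rewrite (ltr_half_width_inv b0)// (lt_trans yb).
    move=> /andP[y0y yh]; have yb := lt_le_trans yh hb.
    by rewrite y0y yb (ltr_half_width_inv b0)// (lt_trans yb).
  have dom y : y0 <= y <= half_width_inv b `|x| -> riemann_dom b (x, y).
    move=> /andP[_ yh]; apply: cone_riemann_dom => //=; first exact: le_trans hb.
    move: yh; rewrite le_eqVlt => /predU1P[->|yh]; first by rewrite (half_widthK b0).
    by rewrite ltW// (ltr_half_width_inv b0)// (lt_trans yh).
  have dQx y : y0 <= y <= half_width_inv b `|x| -> is_derive y (1 : R) (fun s =>
    Q (x, s)) (B (x, y)).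
    by move=> /dom; exact: dQ.
  have cBx y : y0 <= y <= half_width_inv b `|x| -> {for y, continuous (fun s => B (x, s))}.
    move=> /dom D; apply: (@cvg_comp _ _ _ (fun z => (x, z)) B _ (nbhs (x, y))); last exact: cB.
    by apply: (cvg_pair (G := nbhs x) (H := nbhs y)); [exact: cvg_cst|exact: cvg_id].
  rewrite (integral_FTC_oo yt dQx cBx); congr (_%:E).
  (* The base y = y0 contributes nothing, because phi and its y-derivative vanish on it. *)
  by rewrite [X in _ - X](_ : _ = 0) ?subr0// /Q phi_y0 phiy_y0 !mulr0 subr0.
have -> : [set y | triangle (x, y)] = set0.
  apply/seteqP; split => y //= [/= /andP[y0y yb] xy]; apply: xX.
  by apply: lt_trans xy _; apply: half_width_decr.
exact: integral_set0.
Qed.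

Let h_itv y : y0 <= y <= b -> 0 <= h y <= X.
Proof.
move=> /andP[yy yb]; rewrite half_width_ge0//=; move: yy.
by rewrite le_eqVlt => /predU1P[<-|yy]; [exact: lexx|rewrite ltW// half_width_decr].
Qed.

Let near_neg y : y0 <= y <= b -> \forall z \near y, z < 0.
Proof. by move=> /andP[_ yb]; apply: lt_nbhsl; exact: le_lt_trans b0. Qed.

Let continuous_sqrt_opp1 y : {for y, continuous (@sqrt_opp R)}.
Proof.
apply: (continuous_chain (f := -%R) (h := Num.sqrt)); last exact: sqrt_continuous.
by apply: continuousN; exact: cvg_id.
Qed.

(** The substitution x = h(y), dx = - sqrt(-y) dy, reparametrizes the edge by height, so that this
    flux can be added to that of P at the same y. *)
Lemma integral_right_edge : (\int[mu]_(x in `[0%R, X]) (Q (top x))%:E =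
  \int[mu]_(y in `[y0, b]) (Q (1 * h y, y) * sqrt_opp y)%:E)%E.
Proof.
have dh x : y0 <= x <= b -> \forall z \near x, is_derive z (1 : R) h (- sqrt_opp z).
  by move=> /near_neg; apply: filterS => z; exact: is_derive_half_width.
have crt x : y0 <= x <= b -> {for x, continuous (fun z => - sqrt_opp z : R)}.
  by move=> _; apply: continuousN; exact: continuous_sqrt_opp1.
have decr x y : y0 <= x <= b -> y0 <= y <= b -> x < y -> h y < h x.
  by move=> /andP[_ xb] _; apply: half_width_decr; exact: le_lt_trans b0.
have := @integral_substitution_decr _ h (fun z => - sqrt_opp z) (fun x => Q (top x)) y0 b
  (ltW y0b) dh crt decr (fun x _ => @continuous_top Q x cQ).
rewrite half_width_b => ->; apply: eq_integral => y; rewrite inE/= in_itv/= => yy.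
have /andP[hy0 _] := h_itv yy.
by rewrite opprK mul1r /top ger0_norm// (hinv_half_width b0)//; case/andP: yy.
Qed.

Lemma integral_left_edge : (\int[mu]_(x in `[(- X)%R, 0%R]) (Q (top x))%:E =
  \int[mu]_(y in `[y0, b]) (Q (-1 * h y, y) * sqrt_opp y)%:E)%E.
Proof.
have dh x : y0 <= x <= b -> \forall z \near x, is_derive z (1 : R) (fun s =>
  -1 * h s) (sqrt_opp z).
  move=> /near_neg; apply: filterS => z z0.
  by apply: is_derive_eq (is_derive_scale (-1) (is_derive_half_width b z0)) _;
    rewrite mulrNN mul1r.
have crt x : y0 <= x <= b -> {for x, continuous (@sqrt_opp R)}.
  by move=> _; exact: continuous_sqrt_opp1.
have incr x y : y0 <= x <= b -> y0 <= y <= b -> x < y -> -1 * h x < -1 * h y.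
  move=> /andP[_ xb] _ xy; rewrite !mulN1r ltrN2; apply: half_width_decr => //.
  exact: le_lt_trans b0.
have := @integral_substitution_incr _ (fun s => -1 * h s) (@sqrt_opp R) (fun x =>
  Q (top x)) y0 b
  (ltW y0b) dh crt incr (fun x _ => @continuous_top Q x cQ).
rewrite half_width_b mulr0 mulN1r => ->; apply: eq_integral => y; rewrite inE/= in_itv/= => yy.
have /andP[hy0 _] := h_itv yy.
by rewrite /top mulN1r normrN ger0_norm// (hinv_half_width b0)//; case/andP: yy.
Qed.

Lemma integral_split_edges : (\int[mu]_(x in `[(- X)%R, X]) (Q (top x))%:E =
  \int[mu]_(x in `[(- X)%R, 0%R]) (Q (top x))%:E +
  \int[mu]_(x in `[0%R, X]) (Q (top x))%:E)%E.
Proof.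
have mQ a c : measurable_fun (`[a, c]%classic : set (measurableTypeR R))
    (fun x => (Q (top x))%:E).
  apply/measurable_EFinP; apply: measurable_itv_continuous => x _.
  exact: continuous_top.
have NX : - X <= 0 by rewrite oppr_le0.
have -> : `[- X, X]%classic = `[- X, 0[%classic `|` `[0, X]%classic :> set R.
  by rewrite -itv_bndbnd_setU// bnd_simp.
rewrite integral_setU//=.
- congr (_ + _)%E; apply: integral_itv_bndo_bndc.
  apply: measurable_funS (mQ (- X) 0) => //.
  by apply: subset_itvl; rewrite bnd_simp.
- apply: measurable_funS (mQ (- X) X) => // x /=.
  by rewrite !in_itv/=; case=> /andP[? ?]; apply/andP; split; lra.
- apply/disj_setPS => x [/=]; rewrite !in_itv/= => /andP[_ ?] /andP[? _]; lra.
Qed.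

(* [sqrt (- y) * riemann] along the edges, where [n = 0] and [F = 1]. *)
Let edge_weight (y : R) : R := sqrt_opp y * (16 * (sqrt_opp y ^+ 3 * rho ^+ 3)) `^ (- (1 / 6)).

(** Up to a constant the weight is r^(1/2) with r = sqrt(-y), and r' = -1 / (2 r). *)
Let is_derive_edge_weight (y : R) : y < 0 ->
  is_derive y (1 : R) edge_weight (- (edge_weight y / (4 * sqrt_opp y ^+ 2))).
Proof.
move=> yn; have r0 := sqrt_opp_gt0 yn; have rho0 := rho_gt0 b0.
have rn0 : sqrt_opp y != 0 by rewrite gt_eqF.
have rhon0 : rho != 0 by rewrite gt_eqF.
have dw := is_derive_scale 16 (is_derive_mul (is_derive_expr 3 (is_derive_sqrt_opp yn))
  (is_derive_const y (rho ^+ 3))).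
have w0 : 0 < 16 * (sqrt_opp y ^+ 3 * rho ^+ 3) by rewrite mulr_gt0// mulr_gt0// exprn_gt0.
apply: is_derive_eq (is_derive_mul (is_derive_sqrt_opp yn) (is_derive_powR_comp
  (f := fun s => 16 * (sqrt_opp s ^+ 3 * rho ^+ 3)) _ w0 dw)) _.
by rewrite /edge_weight /=; field; rewrite rn0.
Qed.

(* The right-hand side is the derivative of [edge_weight z * phi (s * h z, z)],
   with [s = 1] on the right edge and [s = -1] on the left one. *)
Let edge_flux (s y : R) : y <= b -> s ^+ 2 = 1 ->
  s * P (s * h y, y) + sqrt_opp y * Q (s * h y, y) =
  - (edge_weight y / (4 * sqrt_opp y ^+ 2)) * phi (s * h y, y)
  + edge_weight y * (phix (s * h y, y) * (s * - sqrt_opp y) + phiy (s * h y, y)).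
Proof.
move=> yb s1; have yn : y < 0 by exact: le_lt_trans b0.
have r0 := sqrt_opp_gt0 yn; have rho0 := rho_gt0 b0.
have rn0 : sqrt_opp y != 0 by rewrite gt_eqF.
have rhon0 : rho != 0 by rewrite gt_eqF.
have N0 : coneN b (s * h y, y) = 0.
  by rewrite coneNE /= [(s * _) ^+ 2]exprMn s1 mul1r subrr mulr0.
have WE : coneW b (s * h y, y) = 16 * (sqrt_opp y ^+ 3 * rho ^+ 3).
  by rewrite coneWE N0 add0r.
rewrite /P /Q /G /riemann /riemann_x /riemann_y /edge_weight /profile /profile1 /zeta1.
rewrite N0 WE mul0r hyperF0 /cone_x /coneW_y /coneN_y /= -/rho.
have yE : y = - sqrt_opp y ^+ 2 by rewrite sqrt_opp_sqr// opprK.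
have hE : h y = 2 / 3 * (sqrt_opp y ^+ 3 - rho ^+ 3) by [].
(* The value F'(0) may be generalized: its coefficient is proportional to s y n_x + r n_y, which is
   r times the derivative of n along the edge, and n vanishes identically there. *)
move: (phi _) (phix _) (phiy _) (hyperF1 0) (_ `^ _) => f fx fy F1 k.
rewrite {1}yE hE; move: rn0 rhon0; move: (sqrt_opp y) => r rn0 rhon0.
by move/eqP: s1; rewrite sqrf_eq1 => /orP[]/eqP ->; field; rewrite rn0 rhon0.
Qed.

Lemma green_triangle : (\int[lebesgue2 R]_(p in triangle)
    (G p * (p.2 * phixx p + phiyy p))%:E =
  (2 * (rho * (16 * rho ^+ 6) `^ (- (1 / 6))) * phi (0%R, b))%:E)%E.
Proof.
have -> : (\int[lebesgue2 R]_(p in triangle) (G p * (p.2 * phixx p + phiyy p))%:E =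
    \int[lebesgue2 R]_(p in triangle) ((A p)%:E + (B p)%:E))%E.
  apply: eq_integral => p; rewrite inE => /triangleK/K_dom D.
  by rewrite -EFinD flux_divergence.
have nrm1 : `|1 : R| <= 1 by rewrite normr1.
have nrmN1 : `|-1 : R| <= 1 by rewrite normrN normr1.
rewrite (integralD measurable_triangle (integrable_triangle cA) (integrable_triangle cB)).
rewrite integral_x_flux integral_y_flux integral_split_edges.
rewrite integral_left_edge integral_right_edge.
have cPs s y : `|s| <= 1 -> y0 <= y <= b -> {for y, continuous (fun z => P (s * h z, z))}.
  by move=> s1 /andP[_ yb]; exact: continuous_edge.
have cQs s y : `|s| <= 1 -> y0 <= y <= b ->
    {for y, continuous (fun z => Q (s * h z, z) * sqrt_opp z)}.
  move=> s1 /andP[_ yb]; apply: continuous_mul; last exact: continuous_sqrt_opp1.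
  exact: continuous_edge.
have cPP y : y0 <= y <= b ->
    {for y, continuous (fun z => P (1 * h z, z) - P (-1 * h z, z))}.
  by move=> yy; apply: continuous_sub; exact: cPs.
have mI : measurable (`[y0, b]%classic : set (measurableTypeR R)) by exact: measurable_itv.
have iQ s : `|s| <= 1 -> mu.-integrable `[y0, b] (EFin \o (fun z =>
  Q (s * h z, z) * sqrt_opp z)).
  by move=> s1; apply: continuous_itv_integrable => y; exact: cQs.
rewrite -(integralD mI (iQ _ nrmN1) (iQ _ nrm1)).
have iQQ : mu.-integrable `[y0, b]
    (fun z => (Q (-1 * h z, z) * sqrt_opp z)%:E + (Q (1 * h z, z) * sqrt_opp z)%:E)%E.
  by apply: integrableD => //; exact: iQ.
rewrite -(integralD mI (continuous_itv_integrable cPP) iQQ).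
(* Both edges are summed into one primitive. It vanishes at y0, and at b the two edges meet in (0,
   b), whence the factor 2. *)
pose Psi y := edge_weight y * phi (1 * h y, y) + edge_weight y * phi (-1 * h y, y).
pose psi y := (P (1 * h y, y) - P (-1 * h y, y)) +
  (Q (-1 * h y, y) * sqrt_opp y + Q (1 * h y, y) * sqrt_opp y).
have dPsi y : y0 <= y <= b -> is_derive y (1 : R) Psi (psi y).
  move=> /andP[_ yb]; have yn : y < 0 by exact: le_lt_trans b0.
  have dphi s := is_derive_along_curve (a := fun z => s * h z) (t := y) dphix cphix
    (is_derive_scale s (is_derive_half_width b yn)) (dphiy (s * h y) y).
  have dw := is_derive_edge_weight yn; have sq1N : (-1 : R) ^+ 2 = 1 by rewrite sqrrN expr1n.
  apply: is_derive_eq (is_derive_add (is_derive_mul dw (dphi 1)) (is_derive_mul dw (dphi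
    (-1)))) _.
  rewrite -(edge_flux yb (expr1n _ _)) -(edge_flux yb sq1N) /psi; ring.
have cpsi y : y0 <= y <= b -> {for y, continuous psi}.
  by move=> yy; apply: continuous_add; [exact: cPP|apply: continuous_add; exact: cQs].
transitivity (\int[mu]_(y in `[y0, b]) (psi y)%:E)%E; first exact: eq_integral.
rewrite (integral_FTC (ltW y0b) dPsi cpsi); congr (_%:E).
rewrite /Psi !phi_y0 half_width_b !mulr0 addr0 subr0 /edge_weight.
have -> : 16 * (sqrt_opp b ^+ 3 * rho ^+ 3) = 16 * rho ^+ 6 by rewrite -exprD.
by rewrite -/rho; ring.
Qed.

End green.

(** * The fundamental solution *)

Section partial_derivatives.
Variable R : realType.
Implicit Types (f : R * R -> R) (x y : R).

Lemma difference_quotient_x f x y :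
  (fun h : R => h^-1 *: (f (h *: ((1, 0) : R * R) + (x, y)) - f (x, y))) =
  (fun h : R => h^-1 *: (f (h *: (1 : R) + x, y) - f (x, y))).
Proof.
apply/funext => h; congr (_ *: (f _ - _)).
by apply/pair_equal_spec; split; rewrite //= scaler0 add0r.
Qed.

Lemma difference_quotient_y f x y :
  (fun h : R => h^-1 *: (f (h *: ((0, 1) : R * R) + (x, y)) - f (x, y))) =
  (fun h : R => h^-1 *: (f (x, h *: (1 : R) + y) - f (x, y))).
Proof.
apply/funext => h; congr (_ *: (f _ - _)).
by apply/pair_equal_spec; split; rewrite //= scaler0 add0r.
Qed.

Lemma is_derive_partial_x f x y : derivable f (x, y) ((1, 0) : R * R) ->
  is_derive x (1 : R) (fun s => f (s, y)) (partial_x f (x, y)).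
Proof. by rewrite /derivable /partial_x /derive difference_quotient_x => d; split. Qed.

Lemma is_derive_partial_y f x y : derivable f (x, y) ((0, 1) : R * R) ->
  is_derive y (1 : R) (fun s => f (x, s)) (partial_y f (x, y)).
Proof. by rewrite /derivable /partial_y /derive difference_quotient_y => d; split. Qed.

Lemma is_derive_of_x f (x y d : R) : is_derive x (1 : R) (fun s => f (s, y)) d ->
  is_derive (x, y) ((1, 0) : R * R) f d.
Proof. by move=> [dx <-]; split; rewrite /derivable /derive difference_quotient_x. Qed.

Lemma is_derive_of_y f (x y d : R) : is_derive y (1 : R) (fun s => f (x, s)) d ->
  is_derive (x, y) ((0, 1) : R * R) f d.
Proof. by move=> [dx <-]; split; rewrite /derivable /derive difference_quotient_y. Qed.

Lemma derive_zero_open f (v p : R * R) (U : set (R * R)) : open U ->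
  (forall q, U q -> f q = 0) -> U p -> 'D_v f p = 0.
Proof.
move=> oU f0 Up; have [->|v0] := eqVneq v 0; first by rewrite derive0.
rewrite (near_eq_derive (g := cst 0))// ?derive_cst//.
by apply: filterS (open_nbhs_nbhs (conj oU Up)) => q /f0.
Qed.

End partial_derivatives.

Section fundamental.
Variables (R : realType) (b : R).
Hypothesis b0 : b < 0.

Let closed_cone : set (R * R) := [set p | p.2 <= b] `&` [set p | `|p.1| <= half_width b p.2].

Lemma open_D_minus : open (D_minus b).
Proof.
have -> : D_minus b = [set p | p.2 < b] `&` [set p | `|p.1| < half_width b p.2].
  by apply/seteqP; split => p /(D_minusE b0).
apply: openI; apply: open_lt_continuous => p.
- exact: continuous_snd2.
- exact: continuous_const.
- apply: (continuous_chain (h := Num.norm)); last exact: norm_continuous.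
  exact: continuous_fst2.
- exact: continuous_half_width2.
Qed.

Lemma closed_closed_cone : closed closed_cone.
Proof.
apply: closedI; apply: closed_le_continuous => p.
- exact: continuous_snd2.
- exact: continuous_const.
- apply: (continuous_chain (h := Num.norm)); last exact: norm_continuous.
  exact: continuous_fst2.
- exact: continuous_half_width2.
Qed.

Lemma D_minus_dom : D_minus b `<=` riemann_dom b.
Proof. by move=> p /(D_minusE b0)[? ?]; apply: cone_riemann_dom => //; exact: ltW. Qed.

Let g (p : R * R) : R := riemann b p / 2 `^ (1 / 3).

Let E_minus_restrict : E_minus b = g \_ (D_minus b).
Proof.
apply/funext => p; rewrite patchE; case: ifPn => [|/negbTE pD].
  by rewrite inE => /(E_minusE b0).
by rewrite /E_minus pD.
Qed.

Let cg : {in riemann_dom b, continuous g}.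
Proof.
move=> p; rewrite inE => D; apply: continuous_mul; last exact: continuous_const.
exact: continuous_riemann.
Qed.

(** The part of a compact set lying in the closed cone is compact and contained in [riemann_dom], so
    the continuous function G is bounded on it. *)
Lemma locally_integrable_E_minus : locally_integrable2 (E_minus b).
Proof.
have mD := open_measurable2 open_D_minus.
rewrite E_minus_restrict; split.
  apply/(measurable_restrictT _ mD).
  apply: measurable_funS (continuous_in_measurable2 (@open_riemann_dom R b) cg).
    exact: open_measurable2 (@open_riemann_dom R b).
  exact: D_minus_dom.
move=> K cK; have mK := compact_measurable2 cK.
rewrite -restrict_EFin; apply/(integrable_restrict _ mD mK).
have cC : compact (K `&` closed_cone) by apply: compact_closedI; last exact: closed_closed_cone.
have CO : K `&` closed_cone `<=` riemann_dom b.
  by move=> p [_ [? ?]]; exact: cone_riemann_dom.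
have mKD : measurable (K `&` D_minus b : set (plane R)) by exact: measurableI.
apply: (continuous_in_integrable2 (@open_riemann_dom R b) cg cC CO mKD).
by move=> p [Kp /(D_minusE b0)[? ?]]; split => //; split; exact: ltW.
Qed.

(** The powers of rho cancel and 2 * 16^(-1/6) = 2^(1/3); this fixes the normalization of
    [E_minus]. *)
Lemma edge_constant :
  2 * (sqrt_opp b * (16 * sqrt_opp b ^+ 6) `^ (- (1 / 6))) / 2 `^ (1 / 3) = 1 :> R.
Proof.
have r0 := sqrt_opp_gt0 b0.
have -> : 16 * sqrt_opp b ^+ 6 = 2 `^ 4 * sqrt_opp b `^ 6 :> R.
  by rewrite !powR_mulrn ?(ltW r0)//; ring.
rewrite powRM ?powR_ge0// -!powRrM.
have -> : 6 * - (1 / 6) = -1 :> R by field.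
rewrite powRN powRr1 ?(ltW r0)//.
have E : 2 `^ (4 * - (1 / 6)) / 2 `^ (1 / 3) = 2^-1 :> R.
  rewrite -powRB; last by rewrite pnatr_eq0 implybT.
  have -> : 4 * - (1 / 6) - 1 / 3 = -1 :> R by field.
  by rewrite powRN powRr1.
transitivity (2 * (sqrt_opp b / sqrt_opp b) * (2 `^ (4 * - (1 / 6)) / 2 `^ (1 / 3)) : R);
  first by ring.
by rewrite E divff ?gt_eqF// mulr1 divff// pnatr_eq0.
Qed.

Lemma fundamental_solution_E_minus :
  fundamental_solution (distribution_of_fun (E_minus b)) (0, b).
Proof.
split; first exact: locally_integrable_distribution locally_integrable_E_minus.
move=> phi [sphi cphi].
have [M [M0 KM]] := compact_box cphi.
have phi0 p : p.2 < - M -> phi p = 0.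
  move=> pM; apply: support_out => /KM[_]; rewrite ler_norml => /andP[+ _].
  by rewrite leNgt pM.
have oU : open [set p : R * R | p.2 < - M].
  by apply: open_lt_continuous => p; [exact: continuous_snd2|exact: continuous_const].
have zero_x f : (forall p, p.2 < - M -> f p = 0) ->
    forall p : R * R, p.2 < - M -> partial_x f p = 0.
  by move=> f0 p pM; exact: (derive_zero_open _ oU f0 pM).
have zero_y f : (forall p, p.2 < - M -> f p = 0) ->
    forall p : R * R, p.2 < - M -> partial_y f p = 0.
  by move=> f0 p pM; exact: (derive_zero_open _ oU f0 pM).
(* The truncation height lies below both the vertex and the support of phi; b - M - 1 works because
   M > 0 and b < 0. *)
have [y0 [y0b y0M]] : exists y0, y0 < b /\ y0 < - M.
  by exists (b - M - 1); have := b0; split; lra.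
have [cphi0 dx dy [cx dxx _ [cxx _ _ _ _] _] [cy _ dyy _ [cyy _ _ _ _]]] := sphi 3%N.
have phi_y0 x : phi (x, y0) = 0 by exact: phi0.
have phiy_y0 x : partial_y phi (x, y0) = 0 by exact: zero_y.
have := @green_triangle R b y0 b0 y0b phi (partial_x phi) (partial_x (partial_x phi))
  (partial_y phi) (partial_y (partial_y phi))
  (fun x y => is_derive_partial_x (dx (x, y)))
  (fun x y => is_derive_partial_x (dxx (x, y)))
  (fun x y => is_derive_partial_y (dy (x, y)))
  (fun x y => is_derive_partial_y (dyy (x, y)))
  cphi0 cx cxx cy cyy phi_y0 phiy_y0.
set T := triangle b y0 => green.
rewrite /distribution_of_fun.
(* A point of the cone outside the triangle has height at most y0 < - M, where phi vanishes on an
   open half-plane and so do its derivatives. *)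
have -> : (fun p => E_minus b p * tricomi phi p) =
    (fun p => (2 `^ (1 / 3))^-1 * (riemann b p * tricomi phi p)) \_ T.
  apply/funext => p; rewrite patchE E_minus_restrict patchE.
  have [pT|pT] := boolP (p \in T).
    have pD : D_minus b p.
      by move: pT; rewrite inE => -[/andP[_ ?] ?]; apply/(D_minusE b0).
    by rewrite mem_set// /g; ring.
  case: ifPn => [|_]; last by rewrite mul0r.
  rewrite inE => /(D_minusE b0)[pb ph].
  have pM : p.2 < - M.
    apply: le_lt_trans y0M; rewrite leNgt; apply: contra pT => y0p.
    by rewrite inE; split => //; apply/andP.
  have x2 : partial_x (partial_x phi) p = 0 by exact: (zero_x _ (zero_x _ phi0) p pM).
  have y2 : partial_y (partial_y phi) p = 0 by exact: (zero_y _ (zero_y _ phi0) p pM).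
  by rewrite /tricomi x2 y2 mulr0 addr0 mulr0.
rewrite -Rintegral_mkcond RintegralZl; last 2 first.
- exact: measurable_triangle.
- apply: integrable_triangle => // p D; apply: continuous_mul; first exact: continuous_riemann.
  by apply: continuous_add; [apply: continuous_mul;
    [exact: continuous_snd2|exact: cxx]|exact: cyy].
rewrite /Rintegral; have -> : (\int[lebesgue2 R]_(p in T) (riemann b p * tricomi phi p)%:E =
    (2 * (sqrt_opp b * (16 * sqrt_opp b ^+ 6) `^ (- (1 / 6))) * phi (0, b))%:E)%E.
  by rewrite -green; apply: eq_integral.
by rewrite /= mulrA [_^-1 * _]mulrC edge_constant mul1r.
Qed.

End fundamental.

(** * Bump functions and the support *)

Section smooth_class.
Variable R : realType.
Implicit Types (f g : R * R -> R) (p : R * R).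

Lemma of_class_CW k f : of_class_C k.+1 f -> of_class_C k f.
Proof.
elim: k f => [|k IH] f; first by case.
by move=> [cf dx dy cx cy]; exact: (And5 cf dx dy (IH _ cx) (IH _ cy)).
Qed.

Lemma of_class_C_add k f g : of_class_C k f -> of_class_C k g ->
  of_class_C k (fun p => f p + g p).
Proof.
elim: k f g => [|k IH] f g.
  by move=> cf cg p; apply: continuous_add; [exact: cf|exact: cg].
move=> [cf fx fy cfx cfy] [cg gx gy cgx cgy]; split.
- by move=> p; apply: continuous_add; [exact: cf|exact: cg].
- by move=> p; exact: derivableD (fx p) (gx p).
- by move=> p; exact: derivableD (fy p) (gy p).
- have -> : partial_x (fun p => f p + g p) = (fun p => partial_x f p + partial_x g p).
    by apply/funext => p; exact: deriveD (fx p) (gx p).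
  exact: (IH _ _ cfx cgx).
- have -> : partial_y (fun p => f p + g p) = (fun p => partial_y f p + partial_y g p).
    by apply/funext => p; exact: deriveD (fy p) (gy p).
  exact: (IH _ _ cfy cgy).
Qed.

Lemma of_class_C_mul k f g : of_class_C k f -> of_class_C k g ->
  of_class_C k (fun p => f p * g p).
Proof.
elim: k f g => [|k IH] f g.
  by move=> cf cg p; apply: continuous_mul; [exact: cf|exact: cg].
move=> Cf Cg; have [cf fx fy cfx cfy] := Cf; have [cg gx gy cgx cgy] := Cg; split.
- by move=> p; apply: continuous_mul; [exact: cf|exact: cg].
- by move=> p; exact: derivableM (fx p) (gx p).
- by move=> p; exact: derivableM (fy p) (gy p).
- have -> : partial_x (fun p => f p * g p) =
      (fun p => f p * partial_x g p + g p * partial_x f p).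
    by apply/funext => p; exact: deriveM (fx p) (gx p).
  exact: of_class_C_add (IH _ _ (of_class_CW Cf) cgx) (IH _ _ (of_class_CW Cg) cfx).
- have -> : partial_y (fun p => f p * g p) =
      (fun p => f p * partial_y g p + g p * partial_y f p).
    by apply/funext => p; exact: deriveM (fy p) (gy p).
  exact: of_class_C_add (IH _ _ (of_class_CW Cf) cgy) (IH _ _ (of_class_CW Cg) cfy).
Qed.

Lemma of_class_C_const k (c : R) : of_class_C k (fun=> c : R).
Proof.
elim: k c => [|k IH] c; first exact: cst_continuous.
split; first exact: cst_continuous.
- by move=> p; exact: derivable_cst.
- by move=> p; exact: derivable_cst.
- have -> : partial_x (fun=> c : R) = (fun=> 0) by apply/funext => p; exact: derive_cst.
  exact: IH.
- have -> : partial_y (fun=> c : R) = (fun=> 0) by apply/funext => p; exact: derive_cst.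
  exact: IH.
Qed.

(** The whole sequence is treated at once: each derivative is a combination of the next two members,
    so induction on k with n arbitrary closes. The functions [flat] form such a sequence. *)
Lemma of_class_C_fst (a : nat -> R -> R) (u v : nat -> R) :
  (forall n t, is_derive t (1 : R) (a n) (u n * a n.+1 t + v n * a n.+2 t)) ->
  forall k n, of_class_C k (fun p : R * R => a n p.1).
Proof.
move=> da; have ca n : continuous (fun p : R * R => a n p.1).
  move=> p; apply: (continuous_chain (h := a n)); first exact: continuous_fst2.
  exact: continuous_is_derive (da n _).
have dx n p : is_derive p ((1, 0) : R * R) (fun p : R * R => a n p.1)
    (u n * a n.+1 p.1 + v n * a n.+2 p.1).
  by case: p => x y; apply: is_derive_of_x; exact: da.
have dy n p : is_derive p ((0, 1) : R * R) (fun p : R * R => a n p.1) 0.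
  by case: p => x y; apply: is_derive_of_y; exact: (is_derive_const y (a n x)).
elim=> [|k IH] n; first exact: ca.
split; [exact: ca|by move=> p; exact: (dx n p).(ex_derive)|
  by move=> p; exact: (dy n p).(ex_derive)| |].
- have -> : partial_x (fun p : R * R => a n p.1) =
      (fun p => u n * a n.+1 p.1 + v n * a n.+2 p.1).
    by apply/funext => p; exact: (dx n p).(derive_val).
  by apply: of_class_C_add; apply: of_class_C_mul; (exact: of_class_C_const || exact: IH).
- have -> : partial_y (fun p : R * R => a n p.1) = (fun=> 0).
    by apply/funext => p; exact: (dy n p).(derive_val).
  exact: of_class_C_const.
Qed.

Lemma of_class_C_snd (a : nat -> R -> R) (u v : nat -> R) :
  (forall n t, is_derive t (1 : R) (a n) (u n * a n.+1 t + v n * a n.+2 t)) ->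
  forall k n, of_class_C k (fun p : R * R => a n p.2).
Proof.
move=> da; have ca n : continuous (fun p : R * R => a n p.2).
  move=> p; apply: (continuous_chain (h := a n)); first exact: continuous_snd2.
  exact: continuous_is_derive (da n _).
have dy n p : is_derive p ((0, 1) : R * R) (fun p : R * R => a n p.2)
    (u n * a n.+1 p.2 + v n * a n.+2 p.2).
  by case: p => x y; apply: is_derive_of_y; exact: da.
have dx n p : is_derive p ((1, 0) : R * R) (fun p : R * R => a n p.2) 0.
  by case: p => x y; apply: is_derive_of_x; exact: (is_derive_const x (a n y)).
elim=> [|k IH] n; first exact: ca.
split; [exact: ca|by move=> p; exact: (dx n p).(ex_derive)|
  by move=> p; exact: (dy n p).(ex_derive)| |].
- have -> : partial_x (fun p : R * R => a n p.2) = (fun=> 0).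
    by apply/funext => p; exact: (dx n p).(derive_val).
  exact: of_class_C_const.
- have -> : partial_y (fun p : R * R => a n p.2) =
      (fun p => u n * a n.+1 p.2 + v n * a n.+2 p.2).
    by apply/funext => p; exact: (dy n p).(derive_val).
  by apply: of_class_C_add; apply: of_class_C_mul; (exact: of_class_C_const || exact: IH).
Qed.

End smooth_class.

Section flat_function.
Variable R : realType.
Implicit Types t x : R.

(** The functions t^(-n) exp(-1/t), extended by 0. Those with n > 0 accompany the classical n = 0
    because its successive derivatives are combinations of them. *)
Definition flat (n : nat) t : R := if 0 < t then t^-1 ^+ n * expR (- t^-1) else 0.

Lemma flat_le0 n t : t <= 0 -> flat n t = 0.
Proof. by rewrite /flat ltNge => ->. Qed.

Lemma flat_ge0 n t : 0 <= flat n t.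
Proof.
by rewrite /flat; case: ltP => // t0; rewrite mulr_ge0 ?expR_ge0// exprn_ge0// invr_ge0 ltW.
Qed.

Lemma flat_gt0 n t : 0 < t -> 0 < flat n t.
Proof. by move=> t0; rewrite /flat t0 mulr_gt0 ?expR_gt0// exprn_gt0// invr_gt0. Qed.

(** From exp(x) >= x^(n+1) / (n+1)! at x = 1/t; the spare power of t gives continuity at 0. *)
Lemma flat_bound n t : 0 < t -> flat n t <= (n.+1)`!%:R * t.
Proof.
move=> t0; rewrite /flat t0 expRN ler_pdivrMr ?expR_gt0//.
have x0 : 0 <= t^-1 by rewrite invr_ge0 ltW.
have := expR_ge1Dxn n x0; set e := expR _; set m := _`!%:R => H.
have m0 : 0 < m by rewrite ltr0n fact_gt0.
have : t^-1 ^+ n.+1 <= m * e.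
  by rewrite mulrC -ler_pdivrMr//; apply: le_trans H; rewrite lerDr.
by rewrite exprS mulrC -ler_pdivlMr ?invr_gt0// invrK mulrAC.
Qed.

Lemma continuous_flat0 n : {for 0, continuous (flat n)}.
Proof.
rewrite /prop_for /continuous_at flat_le0//; apply/cvgrPdist_lt => e e0.
have m0 : (0 : R) < (n.+1)`!%:R by rewrite ltr0n fact_gt0.
near=> t; rewrite sub0r normrN ger0_norm ?flat_ge0//.
have [t0|t0] := leP t 0; first by rewrite flat_le0.
apply: le_lt_trans (flat_bound n t0) _; rewrite mulrC -ltr_pdivlMr//.
near: t; apply: lt_nbhsl; exact: divr_gt0.
Unshelve. all: by end_near. Qed.

Lemma is_derive_flat n t : is_derive t (1 : R) (flat n) (- n%:R * flat n.+1 t + flat n.+2 t).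
Proof.
have [t0|t0|->] := ltgtP t 0.
- rewrite !flat_le0 ?(ltW t0)// mulr0 addr0.
  apply: near_eq_is_derive (is_derive_const t 0).
  by near=> z; rewrite flat_le0// ltW//; near: z; exact: lt_nbhsl.
- have tn0 : t != 0 by rewrite gt_eqF.
  have dV := is_derive_inv tn0 (is_derive_id t (1 : R)).
  have dN := is_derive_scale (-1) dV.
  have dE := is_derive_chain (is_derive_expR _) dN.
  apply: (@near_eq_is_derive _ _ _ (fun s : R => s^-1 ^+ n * expR (-1 * s^-1)) (flat n)).
    by near=> z; rewrite /flat mulN1r ifT//; near: z; exact: lt_nbhsr.
  apply: is_derive_eq (is_derive_mul (is_derive_expr n dV) dE) _.
  by rewrite /flat t0 !mulN1r; case: n => [|n] /=; rewrite ?exprS; field.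
(* At 0 the Caratheodory slope is [flat n.+1] itself, since [flat n z] = z * [flat n.+1 z], and it
   is continuous at 0 with value 0. *)
have := @is_derive1_caratheodory R (flat n) 0 (- n%:R * flat n.+1 0 + flat n.+2 0).
move=> [_]; apply; exists (flat n.+1); split.
- move=> z; rewrite [flat n 0]flat_le0// !subr0 /flat; case: ltP => [z0|_];
    last by rewrite mul0r.
  by rewrite exprS; field; rewrite gt_eqF.
- exact: continuous_flat0.
- by rewrite !flat_le0// mulr0 addr0.
Unshelve. all: by end_near. Qed.

Lemma is_derive_flat_affine (s c : R) n t :
  is_derive t (1 : R) (fun z => flat n (s * z + c))
    (- s * n%:R * flat n.+1 (s * t + c) + s * flat n.+2 (s * t + c)).
Proof.
have da := is_derive_add (is_derive_scale s (is_derive_id t (1 : R))) (is_derive_const t c).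
by apply: is_derive_eq (is_derive_chain (is_derive_flat n _) da) _; ring.
Qed.

End flat_function.

Section bump_function.
Variable R : realType.
Variables al be ga de : R.

Definition bump (p : R * R) : R :=
  (flat 0 (p.1 - al) * flat 0 (be - p.1)) * (flat 0 (p.2 - ga) * flat 0 (de - p.2)).

Lemma bump_ge0 p : 0 <= bump p.
Proof. by rewrite !mulr_ge0 ?flat_ge0. Qed.

Lemma bump_gt0 p : al < p.1 < be -> ga < p.2 < de -> 0 < bump p.
Proof.
by move=> /andP[? ?] /andP[? ?]; rewrite !mulr_gt0// flat_gt0 ?subr_gt0.
Qed.

Lemma bump_neq0 p : bump p != 0 -> (al <= p.1 <= be) /\ (ga <= p.2 <= de).
Proof.
rewrite /bump !mulf_eq0 !negb_or => /andP[/andP[h1 h2] /andP[h3 h4]].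
have nz (t : R) : flat 0 t != 0 -> 0 <= t.
  by move=> ft; rewrite leNgt; apply: contra ft => /ltW /flat_le0 ->.
split; apply/andP; split; rewrite -subr_ge0; exact: nz.
Qed.

Let rect : set (R * R) := [set p | (al <= p.1 <= be) /\ (ga <= p.2 <= de)].

Let compact_rect : compact rect.
Proof.
have -> : rect = `[al, be] `*` `[ga, de] :> set (R * R).
  by apply/seteqP; split => p /=; rewrite !in_itv.
by apply: compact_setX; exact: segment_compact.
Qed.

Lemma bump_support : fun_support bump `<=` [set p | (al <= p.1 <= be) /\ (ga <= p.2 <= de)].
Proof.
rewrite /fun_support closureEbigcap => p; apply; split.
  exact: (compact_closed2 compact_rect).
by move=> q /bump_neq0.
Qed.

Lemma bump_test_function : test_function bump.
Proof.
split.
  move=> k.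
  have H1 := @of_class_C_fst R _ _ _ (is_derive_flat_affine 1 (- al)) k 0%N.
  have H2 := @of_class_C_fst R _ _ _ (is_derive_flat_affine (-1) be) k 0%N.
  have H3 := @of_class_C_snd R _ _ _ (is_derive_flat_affine 1 (- ga)) k 0%N.
  have H4 := @of_class_C_snd R _ _ _ (is_derive_flat_affine (-1) de) k 0%N.
  have := of_class_C_mul (of_class_C_mul H1 H2) (of_class_C_mul H3 H4).
  congr (of_class_C k _); apply/funext => p; rewrite /bump /=.
  by rewrite !mul1r !mulN1r ![- _ + _]addrC.
apply: (subclosed_compact _ compact_rect bump_support); exact: closed_closure.
Qed.

End bump_function.

(** * Positivity on the cone and the support *)

Section support.
Variables (R : realType) (b : R).
Hypothesis b0 : b < 0.

Lemma E_minus_gt0 p : D_minus b p -> 0 < E_minus b p.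
Proof.
move=> D; rewrite (E_minusE b0 D); have dom := D_minus_dom b0 D.
have w0 := riemann_dom_W dom; have [_ nw] := dom.
have [pb ph] : p.2 < b /\ `|p.1| < half_width b p.2 by apply/(D_minusE b0).
have n0 : 0 <= coneN b p.
  rewrite coneNE mulr_ge0// subr_ge0 -[leLHS]real_normK ?num_real//.
  by rewrite lerXn2r ?nnegrE ?(ltW ph)// (le_trans _ (ltW ph)).
apply: divr_gt0; last exact: powR_gt0.
apply: mulr_gt0; first exact: powR_gt0.
apply: lt_le_trans (hyperF_ge1 _ _) => //; first by rewrite divr_ge0// ltW.
by rewrite ltr_pdivrMr// mul1r; rewrite ger0_norm in nw.
Qed.

Lemma E_minus_out p : ~ D_minus b p -> E_minus b p = 0.
Proof. by rewrite /E_minus; case: ifPn => //; rewrite inE. Qed.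

(** The integrand is nonnegative, so a zero integral would make it vanish almost everywhere, yet it
    is positive on an open rectangle of positive area. *)
Lemma Rintegral_mul_bump_gt0 (al be ga de : R) : al < be -> ga < de ->
  (forall p, al <= p.1 <= be -> ga <= p.2 <= de -> D_minus b p) ->
  distribution_of_fun (E_minus b) (bump al be ga de) != 0.
Proof.
move=> albe gade sub; apply/eqP => int0.
have tb := bump_test_function al be ga de.
pose f p := E_minus b p * bump al be ga de p.
have f0 p : 0 <= f p.
  apply: mulr_ge0; last exact: bump_ge0.
  by have [/E_minus_gt0/ltW//|/E_minus_out ->] := pselect (D_minus b p).
have intf : (lebesgue2 R).-integrable setT (EFin \o f).
  exact: (integrable_mul (locally_integrable_E_minus b0) (test_function_continuous tb)
    tb.2 (@support_out _ _)).
have mf := measurable_int _ intf.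
have : (\int[lebesgue2 R]_p (f p)%:E = 0)%E.
  by rewrite -[LHS]fineK ?integrable_fin_num//; congr (_%:E).
(* Passing to the absolute value makes the integral-zero criterion for almost everywhere vanishing
   applicable. *)
have -> : (\int[lebesgue2 R]_p (f p)%:E = \int[lebesgue2 R]_p `|(EFin \o f) p|)%E.
  by apply: eq_integral => p _; rewrite /= ger0_norm.
move=> /(ae_eq_integral_abs _ measurableT mf)[N [mN N0 fN]].
pose I : set (measurableTypeR R) := `]al, be[%classic.
pose J : set (measurableTypeR R) := `]ga, de[%classic.
have mI : measurable I by exact: measurable_itv.
have mJ : measurable J by exact: measurable_itv.
have IJN : I `*` J `<=` N.
  move=> p []; rewrite /I /J /= !in_itv/= => pI pJ; apply: fN => /= /(_ Logic.I).
  move=> [fp]; have : 0 < f p.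
    have [/andP[? ?] /andP[? ?]] := (pI, pJ).
    rewrite mulr_gt0 ?bump_gt0//; apply: E_minus_gt0; apply: sub; rewrite !ltW//.
  by rewrite fp ltxx.
have : (lebesgue2 R (I `*` J) <= lebesgue2 R N)%E.
  by apply: le_measure => //; rewrite inE//; exact: measurableX.
have -> : lebesgue2 R (I `*` J) = (lebesgue_measure I * lebesgue_measure J)%E.
  exact: product_measure1E.
rewrite N0 !lebesgue_measure_itv/= !lte_fin albe gade -!EFinB -EFinM lee_fin leNgt.
by rewrite mulr_gt0// subr_gt0.
Qed.

(** Off the closure of [D_minus] the function is zero. Conversely, an open set meeting that closure
    meets the open set [D_minus] itself, hence contains a rectangle inside it, whose bump function
    has nonzero pairing. *)
Lemma distribution_support_E_minus :
  distribution_support (distribution_of_fun (E_minus b)) = closure (D_minus b).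
Proof.
apply/seteqP; split => p.
  move=> np; apply: contrapT => Dp; apply: np.
  exists (~` closure (D_minus b)) => //; split.
    by apply: closed_openC; exact: closed_closure.
  move=> phi tphi sphi; rewrite /distribution_of_fun.
  rewrite (_ : (fun q => _) = (fun=> 0)).
    by rewrite Rintegral_cst// mul0r.
  apply/funext => q; have [Dq|/E_minus_out ->] := pselect (D_minus b q); last by rewrite mul0r.
  rewrite (support_out (phi := phi)) ?mulr0// => /sphi; apply; exact: subset_closure.
move=> Dp [U [oU vU] Up].
have [q [Dq Uq]] := Dp U (open_nbhs_nbhs (conj oU Up)).
have : nbhs q (D_minus b `&` U).
  by apply: filterI; apply: open_nbhs_nbhs; split => //; exact: open_D_minus.
move=> /nbhs_ballP[e /= e0 eDU].
(* Balls in the plane are squares for the product norm, so the closed square of half-side e / 2 fits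
   in the ball of radius e. *)
have inball (x : R * R) : q.1 - e / 2 <= x.1 <= q.1 + e / 2 ->
    q.2 - e / 2 <= x.2 <= q.2 + e / 2 -> (D_minus b `&` U) x.
  move=> /andP[? ?] /andP[? ?]; apply: eDU; split; rewrite /ball/= ltr_norml.
    by apply/andP; split; lra.
  by apply/andP; split; lra.
have /eqP := @Rintegral_mul_bump_gt0 (q.1 - e / 2) (q.1 + e / 2) (q.2 - e / 2)
  (q.2 + e / 2) ltac:(lra) ltac:(lra) (fun x h1 h2 => (inball x h1 h2).1).
apply; apply: vU; first exact: bump_test_function.
by move=> x /bump_support[h1 h2]; exact: (inball x h1 h2).2.
Qed.

End support.

Theorem theorem4p1 (R : realType) (b : R) (hb : b < 0) :
  [/\ locally_integrable2 (E_minus b),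
      fundamental_solution (distribution_of_fun (E_minus b)) (0, b) &
      distribution_support (distribution_of_fun (E_minus b))
        = closure (D_minus b)].
Proof.
split; [exact: locally_integrable_E_minus|exact: fundamental_solution_E_minus|].
exact: distribution_support_E_minus.
Qed.
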